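(* Let $\gamma : I\to\mathbb{R}^4$ be a linearly full Lagrangian curve parameterized by the symplectic arc-length, with symplectic curvatures $\kappa_3=\Lambda(\gamma''',\gamma^{(4)})$ and $\kappa_4=\Lambda(\gamma^{(4)},\gamma^{(5)})$. Then $\gamma$ is a Lagrangian geodesic if and only if $\kappa_3$ is constant and $\kappa_4=\kappa_3^2$ on $I$.
   Context: $I\subset\mathbb{R}$ is an open interval and all maps are smooth. On $\mathbb{R}^4$ let $\Lambda(X,Y)={}^tX J Y=x_1y_3+x_2y_4-x_3y_1-x_4y_2$ be the standard symplectic form. A smooth curve $\gamma:I\to\mathbb{R}^4$ is Lagrangian if $\gamma'(t),\gamma''(t)$ are linearly independent and $\Lambda(\gamma'(t),\gamma''(t))=0$ for all $t$. It is linearly full if $\gamma',\gamma'',\gamma''',\gamma^{(4)}$ are linearly independent at every $t$; for a Lagrangian curve this implies $\Lambda(\gamma'',\gamma''')\neq0$ everywhere. Lagrangian curves are always oriented so that $\Lambda(\gamma'',\gamma''')>0$. The symplectic arc-element is $\sigma_\gamma=\Lambda(\gamma'',\gamma''')^{1/5}dt$, and $\gamma$ is parameterized by the symplectic arc-length if $\Lambda(\gamma'',\gamma''')\equiv1$. Let $\mathcal{L}$ be the space of linearly full Lagrangian curves. A Lagrangian variation of $\gamma\in\mathcal{L}$ is a smooth map $\Gamma:I\times(-\epsilon,\epsilon)\to\mathbb{R}^4$ such that each $\gamma_u=\Gamma(\cdot,u)$ is a linearly full Lagrangian curve and $\Gamma(t,0)=\gamma(t)$ for all $t\in I$. Its infinitesimal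 variation is the vector field $\mathfrak{v}(t)=\partial_u\Gamma|_{(t,0)}$ along $\gamma$. The variation is compactly supported if $\mathfrak{v}$ vanishes outside a closed interval $[a,b]\subset I$. $\gamma\in\mathcal{L}$ is a Lagrangian geodesic if it is a critical point of the symplectic arc-length functional $\ell(\gamma)=\int\sigma_\gamma$ for compactly supported variations, that is, for every compactly supported Lagrangian variation $\Gamma$ of $\gamma$ one has $\frac{d}{du}\left(\int_K\sigma_u\right)\big|_{u=0}=0$, where $\sigma_u=\sigma_{\gamma_u}$ and $K$ is the smallest closed interval containing the support of $\mathfrak{v}$. *)

(* Defs.v *)
From Stdlib Require Import Reals Lra Lia.
From Coquelicot Require Import Coquelicot.
Open Scope R_scope.

Definition R4 : Type := (R * R * R * R)%type.

Definition x1 (X : R4) : R := fst (fst (fst X)).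
Definition x2 (X : R4) : R := snd (fst (fst X)).
Definition x3 (X : R4) : R := snd (fst X).
Definition x4 (X : R4) : R := snd X.

Definition all_coords (P : (R4 -> R) -> Prop) : Prop :=
  P x1 /\ P x2 /\ P x3 /\ P x4.

Definition of_coords (h : (R4 -> R) -> R) : R4 := (h x1, h x2, h x3, h x4).

Definition Lambda (X Y : R4) : R :=
  x1 X * x3 Y + x2 X * x4 Y - x3 X * x1 Y - x4 X * x2 Y.

(* The vectors are w 1, ..., w n, so that [lin_indep n (fun k => D k g t)]
   speaks of the derivatives of orders 1 to n. *)
Definition lin_indep (n : nat) (w : nat -> R4) : Prop :=
  forall c : nat -> R,
    sum_n_m (fun k => scal (c k) (w k)) 1 n = zero ->
    forall k : nat, (1 <= k <= n)%nat -> c k = 0.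

(* The open interval with possibly infinite endpoints a and b.  Curves on it
   are total functions on R whose values outside the interval are irrelevant. *)
Definition Ioo (a b : Rbar) (t : R) : Prop := Rbar_lt a t /\ Rbar_lt t b.

Definition D (n : nat) (g : R -> R4) (t : R) : R4 :=
  of_coords (fun x => Derive_n (fun s => x (g s)) n t).

Definition smooth_curve (a b : Rbar) (g : R -> R4) : Prop :=
  all_coords (fun x => forall (n : nat) (t : R),
    Ioo a b t -> ex_derive_n (fun s => x (g s)) n t).

Definition Lagrangian_curve (a b : Rbar) (g : R -> R4) : Prop :=
  smooth_curve a b g /\
  forall t : R, Ioo a b t ->
    lin_indep 2 (fun k => D k g t) /\ Lambda (D 1 g t) (D 2 g t) = 0.

Definition linearly_full (a b : Rbar) (g : R -> R4) : Prop :=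
  forall t : R, Ioo a b t -> lin_indep 4 (fun k => D k g t).

Definition positively_oriented (a b : Rbar) (g : R -> R4) : Prop :=
  forall t : R, Ioo a b t -> 0 < Lambda (D 2 g t) (D 3 g t).

Definition full_Lagrangian_curve (a b : Rbar) (g : R -> R4) : Prop :=
  Lagrangian_curve a b g /\ linearly_full a b g /\ positively_oriented a b g.

(* Density of the symplectic arc-element with respect to dt. *)
Definition sigma (g : R -> R4) (t : R) : R :=
  Rpower (Lambda (D 2 g t) (D 3 g t)) (1 / 5).

Definition arclength_parameterized (a b : Rbar) (g : R -> R4) : Prop :=
  forall t : R, Ioo a b t -> Lambda (D 2 g t) (D 3 g t) = 1.

Definition kappa3 (g : R -> R4) (t : R) : R := Lambda (D 3 g t) (D 4 g t).
Definition kappa4 (g : R -> R4) (t : R) : R := Lambda (D 4 g t) (D 5 g t).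

(* [G t u] is the point of parameter t on the curve of the family with
   parameter u.  Having [ex_diff_n] for all n at every point of an open set
   means that all mixed partial derivatives exist and are continuous there. *)
Definition smooth_family (a b : Rbar) (eps : R) (G : R -> R -> R4) : Prop :=
  all_coords (fun x => forall (n : nat) (t u : R),
    Ioo a b t -> - eps < u < eps -> ex_diff_n (fun s v => x (G s v)) n t u).

Definition Lagrangian_variation
    (a b : Rbar) (g : R -> R4) (eps : R) (G : R -> R -> R4) : Prop :=
  0 < eps /\
  smooth_family a b eps G /\
  (forall u : R, - eps < u < eps -> full_Lagrangian_curve a b (fun t => G t u)) /\
  (forall t : R, Ioo a b t -> G t 0 = g t).

Definition inf_variation (G : R -> R -> R4) (t : R) : R4 :=
  of_coords (fun x => Derive (fun u => x (G t u)) 0).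

Definition compactly_supported (a b : Rbar) (v : R -> R4) : Prop :=
  exists c d : R, c <= d /\ Ioo a b c /\ Ioo a b d /\
    forall t : R, Ioo a b t -> ~ (c <= t <= d) -> v t = zero.

(* The closure is taken in R; for a compactly supported field it agrees with
   the closure in the interval. *)
Definition support (a b : Rbar) (v : R -> R4) : R -> Prop :=
  adherence (fun t => Ioo a b t /\ v t <> zero).

Definition smallest_closed_interval (S : R -> Prop) (k l : R) : Prop :=
  k <= l /\ (forall t : R, S t -> k <= t <= l) /\
  forall c d : R, c <= d -> (forall t : R, S t -> c <= t <= d) -> c <= k /\ l <= d.

(* If the variation field vanishes identically, K is empty and the condition
   on the integral is trivial; accordingly no [k], [l] satisfy
   [smallest_closed_interval] for the empty set. *)
Definition Lagrangian_geodesic (a b : Rbar) (g : R -> R4) : Prop :=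
  full_Lagrangian_curve a b g /\
  forall (eps : R) (G : R -> R -> R4),
    Lagrangian_variation a b g eps G ->
    compactly_supported a b (inf_variation G) ->
    forall k l : R,
      smallest_closed_interval (support a b (inf_variation G)) k l ->
      is_derive (fun u => RInt (sigma (fun t => G t u)) k l) 0 0.

(* Main.v *)
From Stdlib Require Import Reals Lra Lia Classical.
From Coquelicot Require Import Coquelicot.
Require Import Defs.
Open Scope R_scope.

(** Write Lambda_ij for Lambda(g^(i), g^(j)).  Differentiating Lambda_12 = 0 and
    Lambda_23 = 1 determines the Gram matrix of the frame g', ..., g'''' in
    terms of kappa3, and the vanishing of Lambda^3 on R^4 then gives the Frenet
    equation

      g^(5) = (kappa4 - kappa3^2) g' - kappa3' g'' - kappa3 g'''

    ([Lambda_D5]).  A Lagrangian variation with field v satisfies the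
    linearized constraint Lambda(v', g'') + Lambda(g', v'') = 0, and the
    derivative of its arc-length is the integral of
    (Lambda(v'', g''') + Lambda(g'', v''')) / 5.  Integrating by parts and using
    the Frenet equation and the constraint, this is one fifth of the integral of

      (2 (kappa4 - kappa3^2) + kappa3'') Lambda(v, g') + kappa3' Lambda(v, g'')

    ([first_variation]).  If kappa3 is constant and kappa4 = kappa3^2, it
    vanishes for every variation.

    For the converse one needs enough variations.  The components Lambda(v, g')
    and Lambda(v, g'') of a solution of the linearized constraint can be
    prescribed freely, with support in a short segment, and v can moreover be
    chosen orthogonal to a fixed vector e with Lambda(g', e) not zero there
    ([exists_variation_field]).  Orthogonality to e is what makes such a v
    integrable: the family g + u v + u^2 H e is exactly Lagrangian
    for a function H found by two quadratures
    ([exists_Lagrangian_variation]).  Taking for the two components the values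
    of the two Euler-Lagrange expressions at a point, times a bump function,
    shows that both expressions vanish there ([Euler_Lagrange_of_critical]),
    which says that kappa3' = 0 and kappa4 = kappa3^2. *)

(** * Smooth functions on an open set *)

Lemma is_derive_Rplus (f g : R -> R) (t f' g' : R) :
  is_derive f t f' -> is_derive g t g' ->
  is_derive (fun s => f s + g s) t (f' + g').
Proof. exact (is_derive_plus f g t f' g'). Qed.

Lemma is_derive_Rminus (f g : R -> R) (t f' g' : R) :
  is_derive f t f' -> is_derive g t g' ->
  is_derive (fun s => f s - g s) t (f' - g').
Proof. exact (is_derive_minus f g t f' g'). Qed.

Lemma is_derive_Rscal (c : R) (f : R -> R) (t l : R) :
  is_derive f t l -> is_derive (fun s => c * f s) t (c * l).
Proof. exact (is_derive_scal f t c l). Qed.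

Lemma is_derive_Rmult (f g : R -> R) (t f' g' : R) :
  is_derive f t f' -> is_derive g t g' ->
  is_derive (fun s => f s * g s) t (f' * g t + f t * g').
Proof.
  intros Hf Hg; exact (is_derive_mult f g t f' g' Hf Hg Rmult_comm).
Qed.

Lemma is_derive_eq (f : R -> R) (t l l' : R) :
  is_derive f t l -> l = l' -> is_derive f t l'.
Proof. now intros H <-. Qed.

Lemma is_derive_Rpower (f : R -> R) (c t l : R) :
  0 < f t -> is_derive f t l ->
  is_derive (fun s => Rpower (f s) c) t (c * Rpower (f t) (c - 1) * l).
Proof.
  intros Hpos Hf.
  eapply is_derive_eq.
  - apply (is_derive_comp (fun y => Rpower y c) f t).
    + apply is_derive_Reals, derivable_pt_lim_power, Hpos.
    + exact Hf.
  - unfold scal; simpl; unfold mult; simpl. ring.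
Qed.

Definition smooth_on (U : R -> Prop) (f : R -> R) : Prop :=
  forall (n : nat) (t : R), U t -> ex_derive_n f n t.

(** The derivative of a product is a sum of products of functions with one
    derivative less, so products and inverses have to be handled order by order. *)
Definition times_derivable (U : R -> Prop) (n : nat) (f : R -> R) : Prop :=
  forall (k : nat) (t : R), (k <= n)%nat -> U t -> ex_derive_n f k t.

Lemma Derive_n_Derive (f : R -> R) (k : nat) (t : R) :
  Derive_n (Derive f) k t = Derive_n f (S k) t.
Proof.
  change (Derive f) with (Derive_n f 1).
  rewrite Derive_n_comp. now rewrite Nat.add_1_r.
Qed.

Lemma times_derivable_ext (U : R -> Prop) (n : nat) (f g : R -> R) :
  open U -> (forall t, U t -> f t = g t) ->
  times_derivable U n f -> times_derivable U n g.
Proof.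
  intros HU Hfg Hf k t Hk Ht.
  apply (ex_derive_n_ext_loc f); [|now apply Hf].
  exact (filter_imp _ _ Hfg (HU t Ht)).
Qed.

Lemma times_derivable_S (U : R -> Prop) (n : nat) (f : R -> R) :
  times_derivable U (S n) f <->
  (forall t, U t -> ex_derive f t) /\ times_derivable U n (Derive f).
Proof.
  split.
  - intros H; split.
    + intros t Ht; apply (H 1%nat t); [lia|easy].
    + intros [|k] t Hk Ht; [easy|].
      apply (ex_derive_ext (Derive_n f (S k))).
      * intros s; symmetry; apply Derive_n_Derive.
      * apply (H (S (S k)) t); [lia|easy].
  - intros [H1 H2] [|[|k]] t Hk Ht; [easy|now apply H1|].
    apply (ex_derive_ext (Derive_n (Derive f) k)).
    + intros s; apply Derive_n_Derive.
    + apply (H2 (S k) t); [lia|easy].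
Qed.

(** The induction step of the closure proofs: a differentiation rule gives the
    derivative on [U] only, not as an equality of functions. *)
Lemma times_derivable_is_derive (U : R -> Prop) (n : nat) (f f' : R -> R) :
  open U -> (forall t, U t -> is_derive f t (f' t)) ->
  times_derivable U n f' -> times_derivable U (S n) f.
Proof.
  intros HU Hd Hf'. apply times_derivable_S. split.
  - intros t Ht; exists (f' t); now apply Hd.
  - apply (times_derivable_ext U n f'); auto.
    intros t Ht; symmetry; apply is_derive_unique; now apply Hd.
Qed.

Lemma times_derivable_le (U : R -> Prop) (n m : nat) (f : R -> R) :
  (m <= n)%nat -> times_derivable U n f -> times_derivable U m f.
Proof. intros Hmn H k t Hk; apply H; lia. Qed.

Lemma times_derivable_plus (U : R -> Prop) (n : nat) (f g : R -> R) :
  open U -> times_derivable U n f -> times_derivable U n g ->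
  times_derivable U n (fun t => f t + g t).
Proof.
  intros HU Hf Hg k t Hk Ht.
  apply ex_derive_n_plus; apply (filter_imp U); auto;
    intros s Hs j Hj; [apply Hf|apply Hg]; auto; lia.
Qed.

Lemma times_derivable_mult (U : R -> Prop) (n : nat) : open U ->
  forall f g : R -> R, times_derivable U n f -> times_derivable U n g ->
  times_derivable U n (fun t => f t * g t).
Proof.
  intros HU. induction n as [|n IH]; intros f g Hf Hg.
  - intros k t Hk Ht. now replace k with 0%nat by lia.
  - pose proof (proj1 (times_derivable_S _ _ _) Hf) as [Hf1 Hf2].
    pose proof (proj1 (times_derivable_S _ _ _) Hg) as [Hg1 Hg2].
    assert (Hf0 : times_derivable U n f) by (apply (times_derivable_le U (S n)); auto).
    assert (Hg0 : times_derivable U n g) by (apply (times_derivable_le U (S n)); auto).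
    apply (times_derivable_is_derive U n _
             (fun t => Derive f t * g t + f t * Derive g t)); auto.
    + intros t Ht; apply is_derive_Rmult; apply Derive_correct; auto.
    + apply times_derivable_plus; auto.
Qed.

Lemma times_derivable_inv (U : R -> Prop) (n : nat) : open U ->
  forall f : R -> R, (forall t, U t -> f t <> 0) ->
  times_derivable U n f -> times_derivable U n (fun t => / f t).
Proof.
  intros HU. induction n as [|n IH]; intros f Hnz Hf.
  - intros k t Hk Ht. now replace k with 0%nat by lia.
  - pose proof (proj1 (times_derivable_S _ _ _) Hf) as [Hf1 Hf2].
    assert (Hf0 : times_derivable U n f) by (apply (times_derivable_le U (S n)); auto).
    apply (times_derivable_is_derive U n _
             (fun t => (-1 * Derive f t) * (/ f t * / f t))); auto.
    + intros t Ht.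
      replace (-1 * Derive f t * (/ f t * / f t)) with (- Derive f t / f t ^ 2)
        by (field; auto).
      apply is_derive_inv; [apply Derive_correct|]; auto.
    + apply times_derivable_mult; [easy| |apply times_derivable_mult; auto].
      apply times_derivable_mult; auto.
      intros k t Hk Ht; apply ex_derive_n_const.
Qed.

Lemma smooth_on_times (U : R -> Prop) (f : R -> R) :
  smooth_on U f <-> (forall n, times_derivable U n f).
Proof.
  split; [now intros H n k t _; apply H|].
  intros H n t Ht; now apply (H n n t).
Qed.

Section Closure.
Variable U : R -> Prop.
Hypothesis HU : open U.

Lemma smooth_on_ext (f g : R -> R) :
  (forall t, U t -> f t = g t) -> smooth_on U f -> smooth_on U g.
Proof.
  rewrite !smooth_on_times. intros Hfg Hf n.
  now apply (times_derivable_ext U n f).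
Qed.

Lemma smooth_on_const (c : R) : smooth_on U (fun _ => c).
Proof. intros n t _; apply ex_derive_n_const. Qed.

Lemma smooth_on_plus (f g : R -> R) :
  smooth_on U f -> smooth_on U g -> smooth_on U (fun t => f t + g t).
Proof.
  rewrite !smooth_on_times. intros Hf Hg n; now apply times_derivable_plus.
Qed.

Lemma smooth_on_mult (f g : R -> R) :
  smooth_on U f -> smooth_on U g -> smooth_on U (fun t => f t * g t).
Proof.
  rewrite !smooth_on_times. intros Hf Hg n; now apply times_derivable_mult.
Qed.

Lemma smooth_on_opp (f : R -> R) : smooth_on U f -> smooth_on U (fun t => - f t).
Proof. intros Hf n t Ht; apply ex_derive_n_opp; now apply Hf. Qed.

Lemma smooth_on_minus (f g : R -> R) :
  smooth_on U f -> smooth_on U g -> smooth_on U (fun t => f t - g t).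
Proof.
  intros Hf Hg; apply smooth_on_plus; [easy|now apply smooth_on_opp].
Qed.

Lemma smooth_on_div (f g : R -> R) :
  (forall t, U t -> g t <> 0) ->
  smooth_on U f -> smooth_on U g -> smooth_on U (fun t => f t / g t).
Proof.
  intros Hnz Hf Hg; apply smooth_on_mult; [easy|].
  rewrite smooth_on_times in *; intros n; now apply times_derivable_inv.
Qed.

Lemma smooth_on_is_derive (f f' : R -> R) :
  (forall t, U t -> is_derive f t (f' t)) -> smooth_on U f' -> smooth_on U f.
Proof.
  rewrite !smooth_on_times. intros Hd Hf' n.
  apply (times_derivable_le U (S n)); [lia|].
  now apply (times_derivable_is_derive U n f f').
Qed.

Lemma smooth_on_Derive_n (f : R -> R) (k : nat) :
  smooth_on U f -> smooth_on U (Derive_n f k).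
Proof.
  intros Hf [|n] t Ht; [easy|].
  apply (ex_derive_ext (Derive_n f (n + k))).
  - intros s; symmetry; apply Derive_n_comp.
  - now apply (Hf (S (n + k)) t).
Qed.

Lemma smooth_on_Derive (f : R -> R) : smooth_on U f -> smooth_on U (Derive f).
Proof. exact (smooth_on_Derive_n f 1). Qed.

Lemma smooth_on_step (f : R -> R) (n : nat) (t : R) :
  smooth_on U f -> U t -> is_derive (Derive_n f n) t (Derive_n f (S n) t).
Proof. intros Hf Ht; apply Derive_correct; now apply (Hf (S n) t). Qed.

Lemma smooth_on_continuous (f : R -> R) (t : R) :
  smooth_on U f -> U t -> continuous f t.
Proof.
  intros Hf Ht. apply (ex_derive_continuous f t). now apply (Hf 1%nat t).
Qed.

End Closure.

Lemma smooth_on_combination (U : R -> Prop) (c1 c2 c3 c4 f1 f2 f3 f4 : R -> R) :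
  open U ->
  smooth_on U c1 -> smooth_on U c2 -> smooth_on U c3 -> smooth_on U c4 ->
  smooth_on U f1 -> smooth_on U f2 -> smooth_on U f3 -> smooth_on U f4 ->
  smooth_on U (fun t => c1 t * f1 t + c2 t * f2 t + c3 t * f3 t + c4 t * f4 t).
Proof.
  intros HU; intros.
  apply smooth_on_plus; [exact HU|apply smooth_on_plus; [exact HU|apply smooth_on_plus; [exact HU| |]|]|];
    (apply smooth_on_mult; [exact HU|assumption|assumption]).
Qed.

Lemma smooth_on_union (U V W : R -> Prop) (f : R -> R) :
  (forall t, W t -> U t \/ V t) ->
  smooth_on U f -> smooth_on V f -> smooth_on W f.
Proof. intros H Hf Hg n t Ht; destruct (H t Ht); auto. Qed.

Lemma smooth_on_subset (U W : R -> Prop) (f : R -> R) :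
  (forall t, W t -> U t) -> smooth_on U f -> smooth_on W f.
Proof. intros H Hf n t Ht; auto. Qed.

Lemma Derive_n_agree (U : R -> Prop) (f g : R -> R) (n : nat) (t : R) :
  open U -> (forall s, U s -> f s = g s) -> U t -> Derive_n f n t = Derive_n g n t.
Proof.
  intros HU H Ht. apply Derive_n_ext_loc. exact (filter_imp _ _ H (HU t Ht)).
Qed.

Lemma derivative_of_constant (U : R -> Prop) (f : R -> R) (c t l : R) :
  open U -> (forall s, U s -> f s = c) -> U t -> is_derive f t l -> l = 0.
Proof.
  intros HU Hf Ht Hd.
  rewrite <- (is_derive_unique _ _ _ Hd).
  rewrite (Derive_ext_loc f (fun _ => c)); [apply Derive_const|].
  exact (filter_imp _ _ Hf (HU t Ht)).
Qed.

Lemma derivative_agree (U : R -> Prop) (f h : R -> R) (t l m : R) :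
  open U -> (forall s, U s -> f s = h s) -> U t ->
  is_derive f t l -> is_derive h t m -> l = m.
Proof.
  intros HU H Ht Hf Hh.
  rewrite <- (is_derive_unique _ _ _ Hf), <- (is_derive_unique _ _ _ Hh).
  exact (Derive_n_agree U f h 1 t HU H Ht).
Qed.

(** * A smooth bump *)

(** The functions exp(-1/t)/t^n, extended by zero to t <= 0.  The family is
    needed, rather than the case n = 0 only, because it is closed under
    differentiation up to linear combinations. *)
Definition flat (n : nat) (t : R) : R :=
  if Rle_dec t 0 then 0 else exp (- / t) / t ^ n.

Lemma exp_ge_pow (n : nat) (y : R) : 0 <= y -> y ^ n / INR (Factorial.fact n) <= exp y.
Proof.
  intros Hy. apply Rle_trans with (2 := exp_ge_taylor y n Hy).
  assert (H0 : forall k, 0 <= y ^ k / INR (Factorial.fact k)).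
  { intros k; apply Rdiv_le_0_compat; [now apply pow_le|apply INR_fact_lt_0]. }
  destruct n as [|n]; [simpl; lra|].
  rewrite tech5. pose proof (cond_pos_sum _ n H0). lra.
Qed.

(** exp(1/t) >= (1/t)^(n+2)/(n+2)! makes the function O(t^2) at the origin,
    which is all that its derivative there requires. *)
Lemma flat_le (n : nat) (t : R) : Rabs (flat n t) <= INR (Factorial.fact (n + 2)) * t ^ 2.
Proof.
  pose proof (INR_fact_lt_0 (n + 2)) as Hf. unfold flat. destruct (Rle_dec t 0) as [Ht|Ht].
  - rewrite Rabs_R0. apply Rmult_le_pos; [lra|apply pow2_ge_0].
  - assert (Ht' : 0 < t) by lra.
    pose proof (pow_lt t n Ht') as Hn.
    rewrite Rabs_pos_eq by (apply Rdiv_le_0_compat; [left; apply exp_pos|easy]).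
    apply (Rmult_le_reg_r (t ^ n)); [easy|].
    unfold Rdiv at 1. rewrite Rmult_assoc, Rinv_l, Rmult_1_r by lra.
    rewrite exp_Ropp.
    assert (Hy : 0 <= / t) by (left; now apply Rinv_0_lt_compat).
    pose proof (exp_ge_pow (n + 2) (/ t) Hy) as He.
    rewrite pow_inv in He.
    pose proof (pow_lt t (n + 2) Ht') as Hn2.
    replace (INR (Factorial.fact (n + 2)) * t ^ 2 * t ^ n)
      with (/ (/ t ^ (n + 2) / INR (Factorial.fact (n + 2)))).
    + apply Rinv_le_contravar; [|easy].
      apply Rdiv_lt_0_compat; [now apply Rinv_0_lt_compat|easy].
    + rewrite pow_add. field. split; [|split]; lra.
Qed.

Lemma is_derive_quadratic_0 (f : R -> R) (C : R) :
  (forall t, Rabs (f t) <= C * t ^ 2) -> is_derive f 0 0.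
Proof.
  intros Hf.
  assert (Hf0 : f 0 = 0).
  { specialize (Hf 0). apply Rabs_eq_0. pose proof (Rabs_pos (f 0)). lra. }
  assert (HC : 0 <= C).
  { specialize (Hf 1). pose proof (Rabs_pos (f 1)). lra. }
  apply is_derive_Reals. intros eps Heps.
  assert (Hd : 0 < eps / (C + 1)) by (apply Rdiv_lt_0_compat; lra).
  exists (mkposreal _ Hd). intros h Hh Hhd; simpl in Hhd.
  rewrite Rplus_0_l, Hf0, !Rminus_0_r. unfold Rdiv.
  rewrite Rabs_mult, Rabs_inv.
  assert (Hh0 : 0 < Rabs h) by now apply Rabs_pos_lt.
  apply (Rmult_lt_reg_r (Rabs h)); [easy|].
  rewrite Rmult_assoc, Rinv_l, Rmult_1_r by lra.
  apply Rle_lt_trans with (1 := Hf h). rewrite <- Rsqr_pow2, Rsqr_abs.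
  unfold Rsqr. rewrite <- Rmult_assoc.
  apply Rmult_lt_compat_r; [easy|].
  apply (Rmult_lt_reg_r (/ (C + 1))); [apply Rinv_0_lt_compat; lra|].
  apply Rle_lt_trans with (2 := Hhd).
  apply (Rmult_le_reg_r (C + 1)); [lra|].
  rewrite Rmult_assoc, Rinv_l, Rmult_1_r by lra.
  pose proof (Rabs_pos h). nra.
Qed.

Lemma is_derive_flat (n : nat) (t : R) :
  is_derive (flat n) t (flat (n + 2) t - INR n * flat (n + 1) t).
Proof.
  destruct (Rtotal_order t 0) as [Ht|[->|Ht]].
  - replace (flat (n + 2) t - INR n * flat (n + 1) t) with 0
      by (unfold flat; destruct (Rle_dec t 0); lra).
    apply (is_derive_ext_loc (fun _ => 0));
      [|apply (is_derive_const (K := R_AbsRing) (V := R_NormedModule))].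
    apply (filter_imp (fun s => s < 0)); [|now apply open_lt].
    intros s Hs; unfold flat; destruct (Rle_dec s 0); lra.
  - replace (flat (n + 2) 0 - INR n * flat (n + 1) 0) with 0
      by (unfold flat; destruct (Rle_dec 0 0); lra).
    apply (is_derive_quadratic_0 _ _ (flat_le n)).
  - apply (is_derive_ext_loc (fun s => exp (- / s) / s ^ n)).
    + apply (filter_imp (fun s => 0 < s)); [|now apply open_gt].
      intros s Hs; unfold flat; destruct (Rle_dec s 0); lra.
    + pose proof (pow_lt t n Ht) as Hn.
      auto_derive; [split; lra|].
      unfold flat; destruct (Rle_dec t 0); [lra|].
      rewrite !pow_add. destruct n as [|n].
      * simpl. field. lra.
      * replace (Nat.pred (S n)) with n by easy.
        simpl pow in *. assert (t ^ n <> 0) by (apply pow_nonzero; lra).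
        field. lra.
Qed.

Lemma smooth_flat (n : nat) : smooth_on (fun _ => True) (flat n).
Proof.
  apply smooth_on_times. intros m. revert n.
  assert (HU : open (fun _ : R => True)) by apply open_true.
  induction m as [|m IH]; intros n.
  - intros k t Hk _. now replace k with 0%nat by lia.
  - apply (times_derivable_is_derive _ m _
      (fun t => flat (n + 2) t + (- INR n) * flat (n + 1) t)); auto.
    + intros t _. apply (is_derive_eq _ _ _ _ (is_derive_flat n t)). ring.
    + apply times_derivable_plus; auto. apply times_derivable_mult; auto.
      intros k t _ _; apply ex_derive_n_const.
Qed.

Lemma flat_pos (t : R) : 0 < t -> 0 < flat 0 t.
Proof.
  intros Ht; unfold flat; destruct (Rle_dec t 0); [lra|].
  simpl. rewrite Rdiv_1_r. apply exp_pos.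
Qed.

Lemma flat_zero (t : R) : t <= 0 -> flat 0 t = 0.
Proof. intros Ht; unfold flat; destruct (Rle_dec t 0); lra. Qed.

Definition bump (c d t : R) : R := flat 0 (t - c) * flat 0 (d - t).

Lemma smooth_bump (c d : R) : smooth_on (fun _ => True) (bump c d).
Proof.
  apply smooth_on_mult; [apply open_true| |].
  - intros n t _. apply (ex_derive_n_comp_trans (flat 0) n t (- c)).
    now apply smooth_flat.
  - apply (smooth_on_ext _ open_true (fun t => flat 0 (- (t + - d)))).
    { intros t _; f_equal; ring. }
    intros n t _.
    apply (ex_derive_n_comp_trans (fun s => flat 0 (- s)) n t (- d)).
    apply ex_derive_n_comp_opp. apply filter_forall.
    intros s k _; now apply smooth_flat.
Qed.

Lemma bump_pos (c d t : R) : c < t < d -> 0 < bump c d t.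
Proof. intros Ht; apply Rmult_lt_0_compat; apply flat_pos; lra. Qed.

Lemma bump_zero (c d t : R) : ~ (c < t < d) -> bump c d t = 0.
Proof.
  intros Ht; unfold bump. destruct (Rle_dec t c) as [H|H].
  - rewrite (flat_zero (t - c)) by lra. ring.
  - rewrite (flat_zero (d - t)) by lra. ring.
Qed.

(** * Symplectic linear algebra *)

Lemma Lambda_antisym (X Y : R4) : Lambda X Y = - Lambda Y X.
Proof. unfold Lambda; ring. Qed.

Lemma Lambda_diag (X : R4) : Lambda X X = 0.
Proof. unfold Lambda; ring. Qed.

Lemma Lambda_zero_l (X : R4) : Lambda (0, 0, 0, 0) X = 0.
Proof. unfold Lambda, x1, x2, x3, x4; simpl; ring. Qed.

Lemma Lambda_zero_r (X : R4) : Lambda X (0, 0, 0, 0) = 0.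
Proof. unfold Lambda, x1, x2, x3, x4; simpl; ring. Qed.

(** Six vectors of R^4 have a Gram matrix of vanishing Pfaffian: this is the
    identity Lambda^3 = 0 on R^4.  When the Gram matrix of the first four is
    known and nondegenerate, it computes Lambda(X, Y) from the pairings of X
    and of Y with these four. *)
Lemma Lambda_pfaffian_6 (A1 A2 A3 A4 X Y : R4) :
  let p (a b c d e f : R4) := Lambda a b * Lambda c d * Lambda e f in
    p A1 A2 A3 A4 X Y - p A1 A2 A3 X A4 Y + p A1 A2 A3 Y A4 X
  - p A1 A3 A2 A4 X Y + p A1 A3 A2 X A4 Y - p A1 A3 A2 Y A4 X
  + p A1 A4 A2 A3 X Y - p A1 A4 A2 X A3 Y + p A1 A4 A2 Y A3 X
  - p A1 X A2 A3 A4 Y + p A1 X A2 A4 A3 Y - p A1 X A2 Y A3 A4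
  + p A1 Y A2 A3 A4 X - p A1 Y A2 A4 A3 X + p A1 Y A2 X A3 A4 = 0.
Proof.
  destruct A1 as [[[a1 a2] a3] a4], A2 as [[[b1 b2] b3] b4],
    A3 as [[[c1 c2] c3] c4], A4 as [[[d1 d2] d3] d4],
    X as [[[e1 e2] e3] e4], Y as [[[f1 f2] f3] f4].
  unfold Lambda, x1, x2, x3, x4; simpl. ring.
Qed.

Lemma Lambda_of_coords_l (w : (R4 -> R) -> R) (Y : R4) :
  Lambda (of_coords w) Y = w x1 * x3 Y + w x2 * x4 Y - w x3 * x1 Y - w x4 * x2 Y.
Proof. reflexivity. Qed.

(** The Gram matrix of such vectors is triangular with respect to its
    antidiagonal, so pairing a vanishing combination with A 1, A 2, A 3, A 4 in turn kills the
    coefficients of A 4, A 3, A 2, A 1. *)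
Lemma lin_indep_symplectic_frame (n : nat) (A : nat -> R4) :
  (n <= 4)%nat ->
  Lambda (A 1%nat) (A 2%nat) = 0 -> Lambda (A 1%nat) (A 3%nat) = 0 ->
  Lambda (A 1%nat) (A 4%nat) = - Lambda (A 2%nat) (A 3%nat) ->
  0 < Lambda (A 2%nat) (A 3%nat) ->
  lin_indep n A.
Proof.
  intros Hn H12 H13 H14 H23 c Hc.
  (* Padding with zeros treats all lengths n <= 4 at once. *)
  set (c' := fun k => if Nat.leb k n then c k else 0).
  assert (Hsum : forall X, c' 1%nat * Lambda (A 1%nat) X + c' 2%nat * Lambda (A 2%nat) X
            + c' 3%nat * Lambda (A 3%nat) X + c' 4%nat * Lambda (A 4%nat) X = 0).
  { intros X.
    assert (E : of_coords (fun x => c' 1%nat * x (A 1%nat) + c' 2%nat * x (A 2%nat)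
              + c' 3%nat * x (A 3%nat) + c' 4%nat * x (A 4%nat)) = zero).
    { refine (eq_trans _ Hc). unfold c', of_coords, x1, x2, x3, x4.
      destruct n as [|[|[|[|[|n]]]]]; [| | | | |lia];
        repeat (rewrite sum_n_Sm by lia); rewrite ?sum_n_n, ?sum_n_m_zero by lia;
        simpl.
      all: repeat apply (f_equal2 pair);
        unfold zero, plus, scal, mult; simpl;
        unfold zero, plus, scal, mult; simpl; unfold mult; simpl; ring. }
    apply (f_equal (fun Z => Lambda Z X)) in E.
    rewrite Lambda_of_coords_l in E.
    replace (Lambda zero X) with 0 in E
      by (unfold Lambda, x1, x2, x3, x4, zero; simpl; unfold zero; simpl; ring).
    rewrite <- E. unfold Lambda. ring. }
  assert (Hs := Hsum (A 1%nat)).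
  assert (Hs2 := Hsum (A 2%nat)).
  assert (Hs3 := Hsum (A 3%nat)).
  assert (Hs4 := Hsum (A 4%nat)).
  rewrite !Lambda_diag in *.
  rewrite (Lambda_antisym (A 2%nat) (A 1%nat)), (Lambda_antisym (A 3%nat) (A 1%nat)),
    (Lambda_antisym (A 4%nat) (A 1%nat)), H12, H13, H14 in Hs.
  rewrite (Lambda_antisym (A 3%nat) (A 2%nat)), H12 in Hs2.
  rewrite H13 in Hs3. rewrite H14 in Hs4.
  assert (E4 : c' 4%nat = 0) by nra.
  rewrite E4 in *.
  assert (E3 : c' 3%nat = 0) by nra.
  rewrite E3 in *.
  assert (E2 : c' 2%nat = 0) by nra.
  rewrite E2 in *.
  assert (E1 : c' 1%nat = 0) by nra.
  intros k Hk.
  replace (c k) with (c' k) by (unfold c'; destruct (Nat.leb_spec k n); [easy|lia]).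
  destruct k as [|[|[|[|[|k]]]]]; [lia| | | | |lia]; assumption.
Qed.

(** * Differentiating along curves *)

Lemma open_Ioo (a b : Rbar) : open (Ioo a b).
Proof. apply open_and; [apply open_Rbar_gt|apply open_Rbar_lt]. Qed.

Lemma Ioo_between (a b : Rbar) (c d t : R) :
  Ioo a b c -> Ioo a b d -> c <= t <= d -> Ioo a b t.
Proof.
  intros [H1 _] [_ H2] Ht; split.
  - apply Rbar_lt_le_trans with c; [easy|simpl; lra].
  - apply Rbar_le_lt_trans with d; [simpl; lra|easy].
Qed.

Lemma Ioo_inhabited (a b : Rbar) : Rbar_lt a b -> exists t, Ioo a b t.
Proof.
  destruct a as [a| |], b as [b| |]; simpl; intros H; try easy.
  - exists ((a + b) / 2); split; simpl; lra.
  - exists (a + 1); split; simpl; [lra|easy].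
  - exists (b - 1); split; simpl; [easy|lra].
  - exists 0; split; simpl; easy.
Qed.

Lemma constant_on_Ioo (a b : Rbar) (f : R -> R) (s t : R) :
  (forall z, Ioo a b z -> is_derive f z 0) -> Ioo a b s -> Ioo a b t -> f s = f t.
Proof.
  intros Hf Hs Ht.
  destruct (MVT_gen f s t (fun _ => 0)) as [z [_ E]].
  - intros z Hz. apply Hf. destruct (Rle_dec s t) as [H|H].
    + rewrite Rmin_left, Rmax_right in Hz by easy. apply (Ioo_between a b s t); auto; lra.
    + rewrite Rmin_right, Rmax_left in Hz by lra. apply (Ioo_between a b t s); auto; lra.
  - intros z Hz. apply continuity_pt_filterlim.
    apply (ex_derive_continuous f). exists 0. apply Hf. destruct (Rle_dec s t) as [H|H].
    + rewrite Rmin_left, Rmax_right in Hz by easy. apply (Ioo_between a b s t); auto; lra.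
    + rewrite Rmin_right, Rmax_left in Hz by lra. apply (Ioo_between a b t s); auto; lra.
  - lra.
Qed.

Definition is_derive_R4 (F : R -> R4) (t : R) (F' : R4) : Prop :=
  all_coords (fun x => is_derive (fun s => x (F s)) t (x F')).

Lemma is_derive_Lambda (F G : R -> R4) (t : R) (F' G' : R4) :
  is_derive_R4 F t F' -> is_derive_R4 G t G' ->
  is_derive (fun s => Lambda (F s) (G s)) t (Lambda F' (G t) + Lambda (F t) G').
Proof.
  intros (F1 & F2 & F3 & F4) (G1 & G2 & G3 & G4).
  eapply is_derive_eq.
  - apply is_derive_Rminus; [apply is_derive_Rminus; [apply is_derive_Rplus|]|];
      apply is_derive_Rmult; eassumption.
  - unfold Lambda; ring.
Qed.

Lemma is_derive_R4_D (a b : Rbar) (g : R -> R4) (n : nat) (t : R) :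
  smooth_curve a b g -> Ioo a b t -> is_derive_R4 (D n g) t (D (S n) g t).
Proof.
  intros (H1 & H2 & H3 & H4) Ht.
  split; [|split; [|split]]; apply (smooth_on_step (Ioo a b)); assumption.
Qed.

Lemma is_derive_R4_const (e : R4) (t : R) : is_derive_R4 (fun _ => e) t (0, 0, 0, 0).
Proof.
  split; [|split; [|split]]; apply (is_derive_const (K := R_AbsRing) (V := R_NormedModule)).
Qed.

Lemma D_0 (g : R -> R4) (t : R) : D 0 g t = g t.
Proof. now destruct (g t) as [[[? ?] ?] ?] eqn:E; unfold D, of_coords; simpl; rewrite E. Qed.

Lemma D_agree (U : R -> Prop) (f g : R -> R4) (n : nat) (t : R) :
  open U -> (forall s, U s -> f s = g s) -> U t -> D n f t = D n g t.
Proof.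
  intros HU H Ht.
  repeat apply (f_equal2 pair); apply (Derive_n_agree U); auto; intros s Hs; now rewrite H.
Qed.

Lemma Lambda_D_const (a b : Rbar) (v : R -> R4) (e : R4) (i : nat) (t : R) :
  smooth_curve a b v -> (forall s, Ioo a b s -> Lambda (v s) e = 0) -> Ioo a b t ->
  Lambda (D i v t) e = 0.
Proof.
  intros Hv H0. revert t. induction i as [|i IH]; intros t Ht.
  - rewrite D_0; now apply H0.
  - pose proof (derivative_of_constant (Ioo a b) (fun s => Lambda (D i v s) e) 0 t _
      (open_Ioo a b) IH Ht (is_derive_Lambda _ _ _ _ _ (is_derive_R4_D a b v i t Hv Ht)
        (is_derive_R4_const e t))) as E.
    rewrite Lambda_zero_r in E. lra.
Qed.

Lemma D_scal_const (H : R -> R) (e : R4) (j : nat) (t : R) :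
  D j (fun s => of_coords (fun x => H s * x e)) t = of_coords (fun x => Derive_n H j t * x e).
Proof.
  repeat apply (f_equal2 pair);
    exact (Derive_n_scal_r H j _ t).
Qed.

Lemma smooth_curve_D (a b : Rbar) (g : R -> R4) (n : nat) :
  smooth_curve a b g -> smooth_curve a b (D n g).
Proof.
  intros (H1 & H2 & H3 & H4).
  split; [|split; [|split]]; apply smooth_on_Derive_n; assumption.
Qed.

Lemma smooth_curve_const (a b : Rbar) (e : R4) : smooth_curve a b (fun _ => e).
Proof. split; [|split; [|split]]; apply smooth_on_const. Qed.

Lemma smooth_on_Lambda (a b : Rbar) (f g : R -> R4) :
  smooth_curve a b f -> smooth_curve a b g ->
  smooth_on (Ioo a b) (fun t => Lambda (f t) (g t)).
Proof.
  intros (F1 & F2 & F3 & F4) (G1 & G2 & G3 & G4).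
  pose proof (open_Ioo a b) as HU.
  apply smooth_on_minus; [easy|apply smooth_on_minus; [easy|apply smooth_on_plus; [easy| |]|]|];
    apply smooth_on_mult; assumption.
Qed.

(** * The frame of a Lagrangian curve *)

(** The first and the second derivative of Lambda(g', g'') = 0. *)
Lemma isotropic_frame (a b : Rbar) (g : R -> R4) (t : R) :
  smooth_curve a b g ->
  (forall s, Ioo a b s -> Lambda (D 1 g s) (D 2 g s) = 0) ->
  Ioo a b t ->
  Lambda (D 1 g t) (D 3 g t) = 0 /\
  Lambda (D 1 g t) (D 4 g t) = - Lambda (D 2 g t) (D 3 g t).
Proof.
  intros Hs H12 Ht.
  assert (H13 : forall s, Ioo a b s -> Lambda (D 1 g s) (D 3 g s) = 0).
  { intros s Hs'.
    pose proof (derivative_of_constant _ _ 0 s _ (open_Ioo a b) H12 Hs'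
      (is_derive_Lambda _ _ _ _ _ (is_derive_R4_D a b g 1 s Hs Hs')
         (is_derive_R4_D a b g 2 s Hs Hs'))) as E.
    rewrite Lambda_diag in E. lra. }
  split; [now apply H13|].
  pose proof (derivative_of_constant _ _ 0 t _ (open_Ioo a b) H13 Ht
      (is_derive_Lambda _ _ _ _ _ (is_derive_R4_D a b g 1 t Hs Ht)
         (is_derive_R4_D a b g 3 t Hs Ht))) as E.
  lra.
Qed.

(** For a curve with Lambda(g', g'') = 0, positivity of
    Lambda(g'', g''') alone implies both conditions of linear independence; a
    family has only this one inequality to preserve. *)
Lemma full_Lagrangian_curve_intro (a b : Rbar) (g : R -> R4) :
  smooth_curve a b g ->
  (forall t, Ioo a b t -> Lambda (D 1 g t) (D 2 g t) = 0) ->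
  positively_oriented a b g ->
  full_Lagrangian_curve a b g.
Proof.
  intros Hs H12 Hpos.
  assert (Hind : forall n t, (n <= 4)%nat -> Ioo a b t -> lin_indep n (fun k => D k g t)).
  { intros n t Hn Ht. destruct (isotropic_frame a b g t Hs H12 Ht) as [H13 H14].
    apply lin_indep_symplectic_frame; auto. }
  split; [split; [easy|]|split; [|easy]].
  - intros t Ht; split; [apply Hind; [lia|easy]|now apply H12].
  - intros t Ht; apply Hind; [lia|easy].
Qed.

(** Each relation beyond those of [isotropic_frame] is the derivative of an
    earlier one, starting from Lambda(g'', g''') = 1. *)
Lemma arclength_frame (a b : Rbar) (g : R -> R4) (t : R) :
  full_Lagrangian_curve a b g -> arclength_parameterized a b g -> Ioo a b t ->
  Lambda (D 1 g t) (D 2 g t) = 0 /\ Lambda (D 1 g t) (D 3 g t) = 0 /\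
  Lambda (D 1 g t) (D 4 g t) = -1 /\ Lambda (D 2 g t) (D 3 g t) = 1 /\
  Lambda (D 2 g t) (D 4 g t) = 0 /\ Lambda (D 1 g t) (D 5 g t) = 0 /\
  Lambda (D 2 g t) (D 5 g t) = - kappa3 g t.
Proof.
  intros [[Hs HL] _] H23 Ht.
  assert (H12 : forall s, Ioo a b s -> Lambda (D 1 g s) (D 2 g s) = 0)
    by (intros s Hs'; now apply HL).
  assert (H14 : forall s, Ioo a b s -> Lambda (D 1 g s) (D 4 g s) = -1).
  { intros s Hs'. destruct (isotropic_frame a b g s Hs H12 Hs') as [_ ->].
    now rewrite H23. }
  pose proof (fun i j s (Hs' : Ioo a b s) => is_derive_Lambda _ _ _ _ _
    (is_derive_R4_D a b g i s Hs Hs') (is_derive_R4_D a b g j s Hs Hs')) as HD.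
  assert (H24 : forall s, Ioo a b s -> Lambda (D 2 g s) (D 4 g s) = 0).
  { intros s Hs'.
    pose proof (derivative_of_constant _ _ 1 s _ (open_Ioo a b) H23 Hs' (HD 2%nat 3%nat s Hs')) as E.
    rewrite Lambda_diag in E. lra. }
  pose proof (derivative_of_constant _ _ _ t _ (open_Ioo a b) H14 Ht (HD 1%nat 4%nat t Ht)) as E15.
  pose proof (derivative_of_constant _ _ _ t _ (open_Ioo a b) H24 Ht (HD 2%nat 4%nat t Ht)) as E25.
  rewrite H24 in E15 by easy.
  repeat split; [now apply H12|now apply (isotropic_frame a b)|now apply H14|
    now apply H23|now apply H24|lra|unfold kappa3; lra].
Qed.

(** The expansion of the fifth derivative in the frame g', ..., g'''', written
    through its pairings: the Frenet equation of the curve.  Here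
    Lambda(g''', g^(5)) is the derivative of [kappa3]. *)
Lemma Lambda_D5 (a b : Rbar) (g : R -> R4) (t : R) (X : R4) :
  full_Lagrangian_curve a b g -> arclength_parameterized a b g -> Ioo a b t ->
  Lambda X (D 5 g t) =
    (kappa4 g t - kappa3 g t ^ 2) * Lambda X (D 1 g t)
    - Lambda (D 3 g t) (D 5 g t) * Lambda X (D 2 g t)
    - kappa3 g t * Lambda X (D 3 g t).
Proof.
  intros Hg Ha Ht.
  destruct (arclength_frame a b g t Hg Ha Ht) as (H12 & H13 & H14 & H23 & H24 & H15 & H25).
  pose proof (Lambda_pfaffian_6 (D 1 g t) (D 2 g t) (D 3 g t) (D 4 g t) X (D 5 g t)) as E.
  simpl in E. rewrite H12, H13, H14, H23, H24, H15, H25 in E.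
  rewrite (Lambda_antisym (D 1 g t) X), (Lambda_antisym (D 2 g t) X),
    (Lambda_antisym (D 3 g t) X) in E.
  fold (kappa4 g t) in E. fold (kappa3 g t) in E.
  nra.
Qed.

(** * Integrating the first variation by parts *)

(** The two Euler-Lagrange expressions: five times the first variation in the
    direction v is the integral of
    [euler1 g t * Lambda (v t) (D 1 g t) + euler2 g t * Lambda (v t) (D 2 g t)].
    As [euler2] is the derivative of [kappa3] and the last summand of [euler1]
    is its second derivative, both vanish identically exactly when [kappa3] is
    constant and [kappa4] is its square. *)
Definition euler1 (g : R -> R4) (t : R) : R :=
  2 * (kappa4 g t - kappa3 g t ^ 2) + (kappa4 g t + Lambda (D 3 g t) (D 6 g t)).

Definition euler2 (g : R -> R4) (t : R) : R := Lambda (D 3 g t) (D 5 g t).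

(** What integrating the first variation by parts leaves at the endpoints; each
    term contains v, v' or v''. *)
Definition boundary_term (g v : R -> R4) (t : R) : R :=
  2 * Lambda (D 1 v t) (D 3 g t) - Lambda (D 2 v t) (D 2 g t)
  - 2 * Lambda (D 0 v t) (D 4 g t)
  + kappa3 g t * (Lambda (D 1 v t) (D 1 g t) - 2 * Lambda (D 0 v t) (D 2 g t))
  - euler2 g t * Lambda (D 0 v t) (D 1 g t).

Lemma is_derive_kappa3 (a b : Rbar) (g : R -> R4) (t : R) :
  smooth_curve a b g -> Ioo a b t -> is_derive (kappa3 g) t (euler2 g t).
Proof.
  intros Hs Ht. eapply is_derive_eq.
  - apply is_derive_Lambda; apply (is_derive_R4_D a b); assumption.
  - unfold euler2. rewrite Lambda_diag. ring.
Qed.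

Lemma is_derive_euler2 (a b : Rbar) (g : R -> R4) (t : R) :
  smooth_curve a b g -> Ioo a b t ->
  is_derive (euler2 g) t (kappa4 g t + Lambda (D 3 g t) (D 6 g t)).
Proof.
  intros Hs Ht. eapply is_derive_eq.
  - apply is_derive_Lambda; apply (is_derive_R4_D a b); assumption.
  - reflexivity.
Qed.

(** The first variation of Lambda(g'', g''') is
    Lambda(v'', g''') + Lambda(g'', v''').  Moving all derivatives off v produces
    2 Lambda(v, g^(5)), where the Frenet equation brings in
    kappa3 Lambda(v, g''').  The constraint Lambda(v'', g') = Lambda(v', g'')
    on Lagrangian variations exchanges Lambda(v, g''') for derivatives of
    Lambda(v, g') and Lambda(v, g''), and a last integration by parts leaves
    only these two components of v. *)
Lemma is_derive_boundary_term (a b : Rbar) (g v : R -> R4) (t : R) :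
  full_Lagrangian_curve a b g -> arclength_parameterized a b g ->
  smooth_curve a b v -> Ioo a b t ->
  Lambda (D 1 v t) (D 2 g t) + Lambda (D 1 g t) (D 2 v t) = 0 ->
  is_derive (boundary_term g v) t
    (Lambda (D 2 v t) (D 3 g t) + Lambda (D 2 g t) (D 3 v t)
     - euler1 g t * Lambda (v t) (D 1 g t) - euler2 g t * Lambda (v t) (D 2 g t)).
Proof.
  intros Hg Ha Hv Ht Hc. pose proof (proj1 (proj1 Hg)) as Hs.
  pose proof (fun i j => is_derive_Lambda _ _ _ _ _
    (is_derive_R4_D a b v i t Hv Ht) (is_derive_R4_D a b g j t Hs Ht)) as HD.
  eapply is_derive_eq.
  - apply is_derive_Rminus; [apply is_derive_Rplus; [apply is_derive_Rminus;
      [apply is_derive_Rminus; [apply is_derive_Rscal, HD|apply HD]|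
       apply is_derive_Rscal, HD]|]|].
    + apply is_derive_Rmult; [now apply (is_derive_kappa3 a b)|].
      apply is_derive_Rminus; [apply HD|apply is_derive_Rscal, HD].
    + apply is_derive_Rmult; [now apply (is_derive_euler2 a b)|apply HD].
  - rewrite !D_0. rewrite (Lambda_D5 a b g t (v t) Hg Ha Ht).
    rewrite (Lambda_antisym (D 1 g t)) in Hc.
    rewrite (Lambda_antisym (D 2 g t) (D 3 v t)).
    replace (Lambda (D 2 v t) (D 1 g t)) with (Lambda (D 1 v t) (D 2 g t)) by lra.
    unfold euler1. fold (euler2 g t). ring.
Qed.

Lemma smooth_euler (a b : Rbar) (g : R -> R4) :
  smooth_curve a b g -> smooth_on (Ioo a b) (euler1 g) /\ smooth_on (Ioo a b) (euler2 g).
Proof.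
  intros Hg. pose proof (open_Ioo a b) as HU.
  pose proof (fun i j => smooth_on_Lambda a b _ _ (smooth_curve_D a b g i Hg) (smooth_curve_D a b g j Hg)) as HL.
  split; [|exact (HL 3%nat 5%nat)].
  unfold euler1, kappa3, kappa4.
  apply smooth_on_plus; [easy| |apply smooth_on_plus; auto].
  apply smooth_on_mult; [easy|apply smooth_on_const|].
  apply smooth_on_minus; [easy|auto|].
  apply (smooth_on_ext _ HU (fun t => Lambda (D 3 g t) (D 4 g t) * Lambda (D 3 g t) (D 4 g t))).
  { intros t _; ring. }
  apply smooth_on_mult; auto.
Qed.

(** * Smooth functions of two variables *)

Definition smooth_on2 (W : R -> R -> Prop) (f : R -> R -> R) : Prop :=
  forall (n : nat) (t u : R), W t u -> ex_diff_n f n t u.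

Section TwoVariables.
Variable W : R -> R -> Prop.
Hypothesis HW : forall t u, W t u -> locally_2d W t u.

Lemma smooth_on2_continuous (f : R -> R -> R) (t u : R) :
  smooth_on2 W f -> W t u -> continuity_2d_pt f t u.
Proof. intros Hf H; exact (proj1 (Hf 0%nat t u H)). Qed.

Lemma smooth_on2_partial_t (f : R -> R -> R) :
  smooth_on2 W f -> smooth_on2 W (fun t u => Derive (fun s => f s u) t).
Proof. intros Hf n t u H; apply (Hf (S n) t u H). Qed.

Lemma smooth_on2_partial_u (f : R -> R -> R) :
  smooth_on2 W f -> smooth_on2 W (fun t u => Derive (fun w => f t w) u).
Proof. intros Hf n t u H; apply (Hf (S n) t u H). Qed.

Lemma smooth_on2_ex_derive_t (f : R -> R -> R) (t u : R) :
  smooth_on2 W f -> W t u -> ex_derive (fun s => f s u) t.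
Proof. intros Hf H; apply (Hf 1%nat t u H). Qed.

Lemma smooth_on2_ex_derive_u (f : R -> R -> R) (t u : R) :
  smooth_on2 W f -> W t u -> ex_derive (fun w => f t w) u.
Proof. intros Hf H; apply (Hf 1%nat t u H). Qed.

Lemma smooth_on2_Schwarz (f : R -> R -> R) (t u : R) :
  smooth_on2 W f -> W t u ->
  Derive (fun w => Derive (fun s => f s w) t) u =
  Derive (fun s => Derive (fun w => f s w) u) t.
Proof.
  intros Hf H. symmetry.
  apply (Schwarz f t u).
  - apply (locally_2d_impl W); [|now apply HW].
    apply locally_2d_forall. intros s w Hs. split; [|split; [|split]].
    + now apply smooth_on2_ex_derive_t.
    + now apply smooth_on2_ex_derive_u.
    + apply (smooth_on2_ex_derive_t (fun s w => Derive (fun w' => f s w') w) s w); [|easy].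
      now apply smooth_on2_partial_u.
    + apply (smooth_on2_ex_derive_u (fun s w => Derive (fun s' => f s' w) s) s w); [|easy].
      now apply smooth_on2_partial_t.
  - apply (smooth_on2_continuous (fun s w => Derive (fun z => Derive (fun y => f z y) w) s)); [|easy].
    apply (smooth_on2_partial_t (fun s w => Derive (fun y => f s y) w)).
    now apply smooth_on2_partial_u.
  - apply (smooth_on2_continuous (fun s w => Derive (fun z => Derive (fun y => f y z) s) w)); [|easy].
    apply (smooth_on2_partial_u (fun s w => Derive (fun y => f y w) s)).
    now apply smooth_on2_partial_t.
Qed.

Lemma smooth_on2_Derive_n_t (f : R -> R -> R) (k : nat) :
  smooth_on2 W f -> smooth_on2 W (fun t u => Derive_n (fun s => f s u) k t).
Proof.
  intros Hf; induction k as [|k IH]; [exact Hf|].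
  exact (smooth_on2_partial_t _ IH).
Qed.

Lemma partial_u_Derive_n_t (f : R -> R -> R) (k : nat) (t u : R) :
  smooth_on2 W f -> W t u ->
  Derive (fun w => Derive_n (fun s => f s w) k t) u =
  Derive_n (fun s => Derive (fun w => f s w) u) k t.
Proof.
  intros Hf; revert t; induction k as [|k IH]; intros t H; [easy|].
  refine (eq_trans (smooth_on2_Schwarz (fun t u => Derive_n (fun s => f s u) k t) t u
             (smooth_on2_Derive_n_t f k Hf) H) _).
  apply Derive_ext_loc.
  pose proof (locally_2d_1d_const_y _ _ _ (HW t u H)) as Hloc.
  apply (filter_imp _ _ IH Hloc).
Qed.

End TwoVariables.

Lemma continuity_2d_pt_swap (f : R -> R -> R) (x y : R) :
  continuity_2d_pt f x y -> continuity_2d_pt (fun u v => f v u) y x.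
Proof.
  intros H eps. destruct (H eps) as [d Hd]. exists d.
  intros u v Hu Hv; now apply Hd.
Qed.

Lemma continuity_2d_fst (f : R -> R) (t u : R) :
  continuous f t -> continuity_2d_pt (fun s _ => f s) t u.
Proof.
  intros Hf. apply continuity_2d_pt_filterlim.
  apply (filterlim_comp _ _ _ fst f _ (locally t)); [|exact Hf].
  apply (continuous_fst t u).
Qed.

Lemma continuity_2d_Rpower (f : R -> R -> R) (c x y : R) :
  0 < f x y -> continuity_2d_pt f x y ->
  continuity_2d_pt (fun u v => Rpower (f u v) c) x y.
Proof.
  intros Hpos Hf. rewrite continuity_2d_pt_filterlim in *.
  apply (filterlim_comp _ _ _ (fun z => f (fst z) (snd z)) (fun r => Rpower r c)
           _ _ _ Hf).
  apply (ex_derive_continuous (fun r => Rpower r c)).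
  eexists. apply is_derive_Reals, derivable_pt_lim_power, Hpos.
Qed.

(** * Families of curves *)

Definition strip (a b : Rbar) (eps : R) (t u : R) : Prop :=
  Ioo a b t /\ - eps < u < eps.

Lemma locally_2d_strip (a b : Rbar) (eps t u : R) :
  strip a b eps t u -> locally_2d (strip a b eps) t u.
Proof.
  intros [Ht Hu]. apply locally_2d_locally.
  destruct (open_Ioo a b t Ht) as [d1 H1].
  assert (Ho : open (fun w => - eps < w < eps)) by (apply open_and; [apply open_gt|apply open_lt]).
  destruct (Ho u Hu) as [d2 H2].
  exists (mkposreal _ (Rmin_stable_in_posreal d1 d2)).
  intros [s w] [Hs Hw]; simpl in *. split.
  - apply H1. apply (ball_le (M := R_UniformSpace)) with (2 := Hs). apply Rmin_l.
  - apply H2. apply (ball_le (M := R_UniformSpace)) with (2 := Hw). apply Rmin_r.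
Qed.

(** At u = 0 this is [inf_variation G]; its values at other u are needed to
    differentiate the arc-length near u = 0. *)
Definition velocity (G : R -> R -> R4) (u t : R) : R4 :=
  of_coords (fun x => Derive (fun w => x (G t w)) u).

Definition continuous_R4_2d (F : R -> R -> R4) (u t : R) : Prop :=
  all_coords (fun x => continuity_2d_pt (fun w s => x (F w s)) u t).

Lemma continuity_2d_Lambda (F G : R -> R -> R4) (u t : R) :
  continuous_R4_2d F u t -> continuous_R4_2d G u t ->
  continuity_2d_pt (fun w s => Lambda (F w s) (G w s)) u t.
Proof.
  intros (F1 & F2 & F3 & F4) (G1 & G2 & G3 & G4).
  apply continuity_2d_pt_minus; [apply continuity_2d_pt_minus; [apply continuity_2d_pt_plus|]|];
    apply continuity_2d_pt_mult; assumption.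
Qed.

Section Family.
Variables (a b : Rbar) (eps : R) (G : R -> R -> R4).
Hypothesis HG : smooth_family a b eps G.

Lemma family_coords :
  all_coords (fun x => smooth_on2 (strip a b eps) (fun t u => x (G t u))).
Proof.
  destruct HG as (H1 & H2 & H3 & H4).
  split; [|split; [|split]]; intros n t u [Ht Hu]; auto.
Qed.

Lemma family_smooth_velocity (u : R) :
  - eps < u < eps -> smooth_curve a b (velocity G u).
Proof.
  intros Hu.
  assert (H : all_coords (fun x => smooth_on2 (strip a b eps)
     (fun t w => Derive (fun w' => x (G t w')) w))).
  { destruct family_coords as (H1 & H2 & H3 & H4).
    split; [|split; [|split]];
      apply (smooth_on2_partial_u (strip a b eps) (fun t w => _ (G t w))); assumption. }
  destruct H as (H1 & H2 & H3 & H4).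
  split; [|split; [|split]]; intros [|n] t Ht; try exact I.
  - exact (smooth_on2_ex_derive_t _ _ t u (smooth_on2_Derive_n_t _ _ n H1) (conj Ht Hu)).
  - exact (smooth_on2_ex_derive_t _ _ t u (smooth_on2_Derive_n_t _ _ n H2) (conj Ht Hu)).
  - exact (smooth_on2_ex_derive_t _ _ t u (smooth_on2_Derive_n_t _ _ n H3) (conj Ht Hu)).
  - exact (smooth_on2_ex_derive_t _ _ t u (smooth_on2_Derive_n_t _ _ n H4) (conj Ht Hu)).
Qed.

Lemma family_D_continuous (k : nat) (t u : R) :
  Ioo a b t -> - eps < u < eps ->
  continuous_R4_2d (fun w s => D k (fun s => G s w) s) u t.
Proof.
  intros Ht Hu. destruct family_coords as (H1 & H2 & H3 & H4).
  split; [|split; [|split]];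
    apply (continuity_2d_pt_swap (fun s w => _ (D k (fun s => G s w) s)));
    apply (smooth_on2_continuous (strip a b eps)); try (split; assumption);
    apply (smooth_on2_Derive_n_t (strip a b eps) (fun s w => _ (G s w))); assumption.
Qed.

Lemma family_D_velocity_continuous (k : nat) (t u : R) :
  Ioo a b t -> - eps < u < eps ->
  continuous_R4_2d (fun w s => D k (velocity G w) s) u t.
Proof.
  intros Ht Hu. destruct family_coords as (H1 & H2 & H3 & H4).
  split; [|split; [|split]];
    apply (continuity_2d_pt_swap (fun s w => _ (D k (velocity G w) s)));
    apply (smooth_on2_continuous (strip a b eps)); try (split; assumption);
    apply (smooth_on2_Derive_n_t (strip a b eps)
             (fun s w => Derive (fun w' => _ (G s w')) w));
    apply (smooth_on2_partial_u (strip a b eps) (fun s w => _ (G s w))); assumption.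
Qed.

(** Partial derivatives commute: the t-derivatives of the curves move with the
    t-derivatives of the velocity. *)
Lemma family_is_derive_D (k : nat) (t u : R) :
  Ioo a b t -> - eps < u < eps ->
  is_derive_R4 (fun w => D k (fun s => G s w) t) u (D k (velocity G u) t).
Proof.
  intros Ht Hu. destruct family_coords as (H1 & H2 & H3 & H4).
  assert (HD : forall f, smooth_on2 (strip a b eps) f ->
    is_derive (fun w => Derive_n (fun s => f s w) k t) u
      (Derive_n (fun s => Derive (fun w => f s w) u) k t)).
  { intros f Hf.
    rewrite <- (partial_u_Derive_n_t (strip a b eps) (locally_2d_strip a b eps) f k t u Hf (conj Ht Hu)).
    apply Derive_correct.
    exact (smooth_on2_ex_derive_u _ _ t u (smooth_on2_Derive_n_t _ f k Hf) (conj Ht Hu)). }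
  split; [|split; [|split]].
  - exact (HD _ H1).
  - exact (HD _ H2).
  - exact (HD _ H3).
  - exact (HD _ H4).
Qed.

End Family.

(** * The first variation of arc-length *)

Lemma sigma_continuous (a b : Rbar) (g : R -> R4) (t : R) :
  full_Lagrangian_curve a b g -> Ioo a b t -> continuous (sigma g) t.
Proof.
  intros Hg Ht. pose proof (proj1 (proj1 Hg)) as Hs.
  apply (ex_derive_continuous (sigma g)).
  eexists. apply is_derive_Rpower; [now apply Hg|].
  apply is_derive_Lambda; apply (is_derive_R4_D a b); assumption.
Qed.

Lemma is_derive_sigma_family (a b : Rbar) (eps : R) (G : R -> R -> R4) (t u : R) :
  smooth_family a b eps G -> full_Lagrangian_curve a b (fun s => G s u) ->
  Ioo a b t -> - eps < u < eps ->
  is_derive (fun w => sigma (fun s => G s w) t) u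
   (1 / 5 * Rpower (Lambda (D 2 (fun s => G s u) t) (D 3 (fun s => G s u) t)) (1 / 5 - 1)
     * (Lambda (D 2 (velocity G u) t) (D 3 (fun s => G s u) t)
        + Lambda (D 2 (fun s => G s u) t) (D 3 (velocity G u) t))).
Proof.
  intros HG Hfull Ht Hu.
  apply (is_derive_Rpower (fun w => Lambda (D 2 (fun s => G s w) t) (D 3 (fun s => G s w) t))).
  - exact (proj2 (proj2 Hfull) t Ht).
  - apply (is_derive_Lambda (fun w => D 2 (fun s => G s w) t) (fun w => D 3 (fun s => G s w) t));
      apply (family_is_derive_D a b eps); assumption.
Qed.

Lemma is_derive_arclength_family (a b : Rbar) (g : R -> R4) (eps : R) (G : R -> R -> R4) (k l : R) :
  arclength_parameterized a b g -> Lagrangian_variation a b g eps G ->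
  k <= l -> Ioo a b k -> Ioo a b l ->
  is_derive (fun u => RInt (sigma (fun t => G t u)) k l) 0
    (RInt (fun t => 1 / 5 * (Lambda (D 2 (inf_variation G) t) (D 3 g t)
                             + Lambda (D 2 g t) (D 3 (inf_variation G) t))) k l).
Proof.
  intros Ha (Heps & HG & Hfull & H0) Hkl Hk Hl.
  assert (H00 : - eps < 0 < eps) by lra.
  assert (Hin : forall t, Rmin k l <= t <= Rmax k l -> Ioo a b t).
  { intros t. rewrite Rmin_left, Rmax_right by easy. now apply Ioo_between. }
  assert (Hloc : locally 0 (fun u => - eps < u < eps)).
  { apply (open_and (fun u => - eps < u) (fun u => u < eps)); [apply open_gt|apply open_lt|lra]. }
  eapply is_derive_eq.
  - apply (is_derive_RInt_param (fun u t => sigma (fun s => G s u) t)).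
    + apply (filter_imp (fun u => - eps < u < eps)); [|exact Hloc].
      intros u Hu t Ht. eexists.
      apply (is_derive_sigma_family a b eps); auto.
    + intros t Ht.
      apply (continuity_2d_pt_ext_loc (fun u t =>
        1 / 5 * Rpower (Lambda (D 2 (fun s => G s u) t) (D 3 (fun s => G s u) t)) (1 / 5 - 1)
     * (Lambda (D 2 (velocity G u) t) (D 3 (fun s => G s u) t)
        + Lambda (D 2 (fun s => G s u) t) (D 3 (velocity G u) t)))).
      * assert (Hst : locally_2d (strip a b eps) t 0)
          by (apply locally_2d_strip; split; auto).
        destruct Hst as [d Hd]. exists d. intros u s Hu Hs.
        destruct (Hd s u Hs Hu) as [Hs' Hu'].
        symmetry. apply is_derive_unique. apply (is_derive_sigma_family a b eps); auto.
      * specialize (Hin t Ht).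
        pose proof (fun j => family_D_continuous a b eps G HG j t 0 Hin H00) as HC.
        pose proof (fun j => family_D_velocity_continuous a b eps G HG j t 0 Hin H00) as HV.
        apply continuity_2d_pt_mult; [apply continuity_2d_pt_mult|apply continuity_2d_pt_plus].
        -- apply continuity_2d_pt_const.
        -- apply (continuity_2d_Rpower (fun u t => Lambda (D 2 (fun s => G s u) t) (D 3 (fun s => G s u) t))).
           ++ exact (proj2 (proj2 (Hfull 0 H00)) t Hin).
           ++ apply (continuity_2d_Lambda _ _ _ _ (HC 2%nat) (HC 3%nat)).
        -- apply (continuity_2d_Lambda _ _ _ _ (HV 2%nat) (HC 3%nat)).
        -- apply (continuity_2d_Lambda _ _ _ _ (HC 2%nat) (HV 3%nat)).
    + apply (filter_imp (fun u => - eps < u < eps)); [|exact Hloc].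
      intros u Hu. apply (ex_RInt_continuous (V := R_CompleteNormedModule)).
      intros t Ht. apply (sigma_continuous a b); auto.
  - apply RInt_ext. intros t Ht.
    assert (Ht' : Ioo a b t) by (apply Hin; lra).
    refine (eq_trans (is_derive_unique _ _ _
      (is_derive_sigma_family a b eps G t 0 HG (Hfull 0 H00) Ht' H00)) _).
    rewrite !(fun n => D_agree (Ioo a b) (fun s => G s 0) g n t (open_Ioo a b) H0 Ht').
    rewrite (Ha t Ht'). unfold Rpower. rewrite ln_1, Rmult_0_r, exp_0.
    change (velocity G 0) with (inf_variation G). ring.
Qed.

(** Derivatives vanish on [V], and by continuity also at a point of [U] that
    [V] approaches. *)
Lemma Derive_n_zero_at_limit (U V : R -> Prop) (f : R -> R) (n : nat) (t : R) :
  open V -> smooth_on U f -> U t ->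
  (forall s, V s -> f s = 0) ->
  (forall P : R -> Prop, locally t P -> exists s, P s /\ V s) ->
  Derive_n f n t = 0.
Proof.
  intros HV Hf Ht H0 Hadh.
  destruct (Req_dec (Derive_n f n t) 0) as [E|E]; [easy|exfalso].
  pose proof (ex_derive_continuous (Derive_n f n) t (Hf (S n) t Ht)) as Hc.
  destruct (Hadh _ (Hc _ (open_neq 0 _ E))) as [s [Hs1 Hs2]].
  apply Hs1. rewrite (Derive_n_agree V f (fun _ => 0) n s HV H0 Hs2).
  destruct n as [|n]; [easy|apply Derive_n_const].
Qed.

Lemma D_zero_at_limit (a b : Rbar) (V : R -> Prop) (v : R -> R4) (n : nat) (t : R) :
  open V -> smooth_curve a b v -> Ioo a b t ->
  (forall s, V s -> v s = (0, 0, 0, 0)) ->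
  (forall P : R -> Prop, locally t P -> exists s, P s /\ V s) ->
  D n v t = (0, 0, 0, 0).
Proof.
  intros HV (H1 & H2 & H3 & H4) Ht H0 Hadh.
  repeat apply (f_equal2 pair); apply (Derive_n_zero_at_limit (Ioo a b) V); auto;
    intros s Hs; now rewrite H0.
Qed.

(** The variation field vanishes just outside [k, l] in the open interval, so all
    its derivatives vanish at k and l, and the boundary terms disappear. *)
Lemma D_zero_endpoints (a b : Rbar) (v : R -> R4) (k l : R) (n : nat) :
  smooth_curve a b v -> Ioo a b k -> Ioo a b l ->
  (forall t, Ioo a b t -> ~ (k <= t <= l) -> v t = (0, 0, 0, 0)) ->
  D n v k = (0, 0, 0, 0) /\ D n v l = (0, 0, 0, 0).
Proof.
  intros Hv Hk Hl H0. split.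
  - apply (D_zero_at_limit a b (fun s => Ioo a b s /\ s < k)); auto.
    + apply open_and; [apply open_Ioo|apply open_lt].
    + intros s [Hs Hsk]; apply H0; [easy|lra].
    + intros P HP. destruct (filter_and _ _ HP (open_Ioo a b k Hk)) as [d Hd].
      exists (k - d / 2). pose proof (cond_pos d) as Hdp.
      destruct (Hd (k - d / 2)) as [HP' HU].
      * unfold ball; simpl; unfold AbsRing_ball, abs, minus, plus, opp; simpl.
        rewrite Rabs_left; lra.
      * repeat split; [easy|apply HU|apply HU|lra].
  - apply (D_zero_at_limit a b (fun s => Ioo a b s /\ l < s)); auto.
    + apply open_and; [apply open_Ioo|apply open_gt].
    + intros s [Hs Hsk]; apply H0; [easy|lra].
    + intros P HP. destruct (filter_and _ _ HP (open_Ioo a b l Hl)) as [d Hd].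
      exists (l + d / 2). pose proof (cond_pos d) as Hdp.
      destruct (Hd (l + d / 2)) as [HP' HU].
      * unfold ball; simpl; unfold AbsRing_ball, abs, minus, plus, opp; simpl.
        rewrite Rabs_right; lra.
      * repeat split; [easy|apply HU|apply HU|lra].
Qed.

(** The derivative at u = 0 of Lambda(gamma_u', gamma_u'') = 0. *)
Lemma variation_constraint (a b : Rbar) (g : R -> R4) (eps : R) (G : R -> R -> R4) (t : R) :
  Lagrangian_variation a b g eps G -> Ioo a b t ->
  Lambda (D 1 (inf_variation G) t) (D 2 g t) + Lambda (D 1 g t) (D 2 (inf_variation G) t) = 0.
Proof.
  intros (Heps & HG & Hfull & H0) Ht.
  assert (H00 : - eps < 0 < eps) by lra.
  rewrite <- !(fun n => D_agree (Ioo a b) (fun s => G s 0) g n t (open_Ioo a b) H0 Ht).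
  apply (derivative_of_constant (fun u => - eps < u < eps)
    (fun u => Lambda (D 1 (fun s => G s u) t) (D 2 (fun s => G s u) t)) 0 0); auto.
  - apply open_and; [apply open_gt|apply open_lt].
  - intros u Hu; exact (proj2 (proj2 (proj1 (Hfull u Hu)) t Ht)).
  - apply (is_derive_Lambda (fun w => D 1 (fun s => G s w) t) (fun w => D 2 (fun s => G s w) t));
      apply (family_is_derive_D a b eps); auto.
Qed.

(** Differentiate under the integral sign at u = 0, where the arc-length element
    is 1, and integrate by parts with [is_derive_boundary_term]. *)
Lemma first_variation (a b : Rbar) (g : R -> R4) (eps : R) (G : R -> R -> R4) (k l : R) :
  full_Lagrangian_curve a b g -> arclength_parameterized a b g ->
  Lagrangian_variation a b g eps G ->
  k <= l -> Ioo a b k -> Ioo a b l ->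
  (forall t, Ioo a b t -> ~ (k <= t <= l) -> inf_variation G t = (0, 0, 0, 0)) ->
  is_derive (fun u => RInt (sigma (fun t => G t u)) k l) 0
    (1 / 5 * RInt (fun t => euler1 g t * Lambda (inf_variation G t) (D 1 g t)
                          + euler2 g t * Lambda (inf_variation G t) (D 2 g t)) k l).
Proof.
  intros Hg Ha HG Hkl Hk Hl Hout.
  pose proof (proj1 (proj1 Hg)) as Hs.
  set (v := inf_variation G) in *.
  assert (Hv : smooth_curve a b v)
    by (apply (family_smooth_velocity a b eps G); [apply HG|destruct HG; lra]).
  pose proof (open_Ioo a b) as HU.
  assert (Hin : forall t, Rmin k l <= t <= Rmax k l -> Ioo a b t).
  { intros t. rewrite Rmin_left, Rmax_right by easy. now apply Ioo_between. }
  set (F := fun t => euler1 g t * Lambda (v t) (D 1 g t) + euler2 g t * Lambda (v t) (D 2 g t)).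
  assert (HF : smooth_on (Ioo a b) F).
  { destruct (smooth_euler a b g Hs) as [S1 S2].
    pose proof (fun j => smooth_on_Lambda a b _ _ Hv (smooth_curve_D a b g j Hs)) as HLv.
    exact (smooth_on_plus _ HU _ _ (smooth_on_mult _ HU _ _ S1 (HLv 1%nat))
             (smooth_on_mult _ HU _ _ S2 (HLv 2%nat))). }
  set (delta := fun t => Lambda (D 2 v t) (D 3 g t) + Lambda (D 2 g t) (D 3 v t)).
  assert (Hdelta : smooth_on (Ioo a b) delta).
  { pose proof (fun j => smooth_curve_D a b g j Hs) as HDg.
    pose proof (fun j => smooth_curve_D a b v j Hv) as HDv.
    apply smooth_on_plus; [easy| |].
    - exact (smooth_on_Lambda a b _ _ (HDv 2%nat) (HDg 3%nat)).
    - exact (smooth_on_Lambda a b _ _ (HDg 2%nat) (HDv 3%nat)). }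
  assert (HB : is_RInt (fun t => delta t - F t) k l (boundary_term g v l - boundary_term g v k)).
  { apply (is_RInt_derive (boundary_term g v)).
    - intros t Ht. specialize (Hin t Ht). eapply is_derive_eq.
      + apply (is_derive_boundary_term a b); auto.
        now apply (variation_constraint a b g eps).
      + unfold delta, F. ring.
    - intros t Ht. apply (smooth_on_continuous (Ioo a b)); [|auto].
      now apply smooth_on_minus. }
  assert (E : boundary_term g v l - boundary_term g v k = 0).
  { unfold boundary_term.
    rewrite !(fun n => proj1 (D_zero_endpoints a b v k l n Hv Hk Hl Hout)),
      !(fun n => proj2 (D_zero_endpoints a b v k l n Hv Hk Hl Hout)), !Lambda_zero_l.
    ring. }
  rewrite E in HB.
  assert (HFi : is_RInt F k l (RInt F k l)).
  { apply (RInt_correct (V := R_CompleteNormedModule)).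
    apply (ex_RInt_continuous (V := R_CompleteNormedModule)).
    intros t Ht; apply (smooth_on_continuous (Ioo a b)); auto. }
  eapply is_derive_eq; [apply (is_derive_arclength_family a b g eps G); auto|].
  apply is_RInt_unique.
  apply (is_RInt_scal (V := R_NormedModule) delta k l (1 / 5) (RInt F k l)).
  pose proof (is_RInt_plus _ _ _ _ _ _ HB HFi) as Hsum.
  replace (RInt F k l) with (plus 0 (RInt F k l)) at 1 by (unfold plus; simpl; ring).
  refine (is_RInt_ext _ _ _ _ _ _ Hsum).
  intros t _. unfold plus; simpl. ring.
Qed.

(** * Families depending quadratically on the parameter *)

(** Functions f0(t) + u f1(t) + u^2 f2(t) are stable under both partial
    derivatives.  The formula for [F] is assumed for t in [U] only, because the
    induction passes to partial derivatives, which are known there only. *)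
Lemma ex_diff_n_quadratic (U : R -> Prop) (n : nat) : open U ->
  forall (F : R -> R -> R) (f0 f1 f2 : R -> R),
  (forall s w, U s -> F s w = f0 s + w * f1 s + w ^ 2 * f2 s) ->
  smooth_on U f0 -> smooth_on U f1 -> smooth_on U f2 ->
  forall t u, U t -> ex_diff_n F n t u.
Proof.
  intros HU. induction n as [|n IH]; intros F f0 f1 f2 HF H0 H1 H2 t u Ht.
  all: assert (Hc : continuity_2d_pt F t u).
  1,3: apply (continuity_2d_pt_ext_loc (fun s w => f0 s + w * f1 s + w * w * f2 s));
    [ destruct (HU t Ht) as [d Hd]; exists d; intros s w Hs _;
      rewrite HF by (now apply Hd); ring
    | pose proof (fun f Hf => continuity_2d_fst f t u (smooth_on_continuous U f t Hf Ht)) as Hcf;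
      repeat first [apply continuity_2d_pt_plus | apply continuity_2d_pt_mult
                   | apply continuity_2d_pt_id2 | now apply Hcf] ].
  - now split.
  - assert (Dt : forall s w, U s ->
      is_derive (fun z => F z w) s (Derive f0 s + w * Derive f1 s + w ^ 2 * Derive f2 s)).
    { intros s w Hs.
      apply (is_derive_ext_loc (fun z => f0 z + w * f1 z + w ^ 2 * f2 z)).
      - apply (filter_imp U); [|now apply HU]. intros z Hz; now rewrite HF.
      - apply is_derive_Rplus; [apply is_derive_Rplus|].
        + exact (smooth_on_step U f0 0 s H0 Hs).
        + apply is_derive_Rscal. exact (smooth_on_step U f1 0 s H1 Hs).
        + apply is_derive_Rscal. exact (smooth_on_step U f2 0 s H2 Hs). }
    assert (Du : forall s w, U s ->
      is_derive (fun z => F s z) w (f1 s + w * (2 * f2 s) + w ^ 2 * 0)).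
    { intros s w Hs.
      apply (is_derive_ext (fun z => f0 s + z * f1 s + z ^ 2 * f2 s)).
      - intros z; now rewrite HF.
      - auto_derive; [easy|ring]. }
    split; [exact Hc|split; [|split; [|split]]].
    + eexists; now apply Dt.
    + eexists; now apply Du.
    + apply (IH _ (Derive f0) (Derive f1) (Derive f2)); auto using smooth_on_Derive.
      intros s w Hs; apply is_derive_unique; now apply Dt.
    + apply (IH _ f1 (fun s => 2 * f2 s) (fun _ => 0)); auto.
      * intros s w Hs; apply is_derive_unique; now apply Du.
      * apply smooth_on_mult; auto. apply smooth_on_const.
      * apply smooth_on_const.
Qed.

Lemma Derive_n_quadratic (U : R -> Prop) (f0 f1 f2 : R -> R) (u t : R) (k : nat) :
  open U -> smooth_on U f0 -> smooth_on U f1 -> smooth_on U f2 -> U t ->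
  Derive_n (fun s => f0 s + u * f1 s + u ^ 2 * f2 s) k t =
  Derive_n f0 k t + u * Derive_n f1 k t + u ^ 2 * Derive_n f2 k t.
Proof.
  intros HU H0 H1 H2. revert t; induction k as [|k IH]; intros t Ht; [easy|].
  apply is_derive_unique.
  apply (is_derive_ext_loc (fun s => Derive_n f0 k s + u * Derive_n f1 k s + u ^ 2 * Derive_n f2 k s)).
  - apply (filter_imp U); [|now apply HU]. intros s Hs; now rewrite IH.
  - apply is_derive_Rplus; [apply is_derive_Rplus|].
    + exact (smooth_on_step U f0 k t H0 Ht).
    + apply is_derive_Rscal. exact (smooth_on_step U f1 k t H1 Ht).
    + apply is_derive_Rscal. exact (smooth_on_step U f2 k t H2 Ht).
Qed.

Definition quadratic (X0 X1 X2 : R4) (u : R) : R4 :=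
  of_coords (fun x => x X0 + u * x X1 + u ^ 2 * x X2).

Lemma Lambda_quadratic (X0 X1 X2 Y0 Y1 Y2 : R4) (u : R) :
  Lambda (quadratic X0 X1 X2 u) (quadratic Y0 Y1 Y2 u) =
  Lambda X0 Y0 + u * (Lambda X1 Y0 + Lambda X0 Y1)
  + u ^ 2 * (Lambda X1 Y1 + Lambda X2 Y0 + Lambda X0 Y2)
  + u ^ 3 * (Lambda X1 Y2 + Lambda X2 Y1) + u ^ 4 * Lambda X2 Y2.
Proof.
  unfold Lambda, quadratic, of_coords, x1, x2, x3, x4; simpl; ring.
Qed.

Section Quadratic.
Variables (a b : Rbar) (g v w : R -> R4).
Hypotheses (Hg : smooth_curve a b g) (Hv : smooth_curve a b v) (Hw : smooth_curve a b w).

Lemma smooth_family_quadratic (eps : R) :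
  smooth_family a b eps (fun t u => quadratic (g t) (v t) (w t) u).
Proof.
  destruct Hg as (G1 & G2 & G3 & G4), Hv as (V1 & V2 & V3 & V4), Hw as (W1 & W2 & W3 & W4).
  pose proof (open_Ioo a b) as HU.
  split; [|split; [|split]]; intros n t u Ht Hu.
  - exact (ex_diff_n_quadratic _ n HU _ _ _ _ (fun s w _ => eq_refl) G1 V1 W1 t u Ht).
  - exact (ex_diff_n_quadratic _ n HU _ _ _ _ (fun s w _ => eq_refl) G2 V2 W2 t u Ht).
  - exact (ex_diff_n_quadratic _ n HU _ _ _ _ (fun s w _ => eq_refl) G3 V3 W3 t u Ht).
  - exact (ex_diff_n_quadratic _ n HU _ _ _ _ (fun s w _ => eq_refl) G4 V4 W4 t u Ht).
Qed.

Lemma D_quadratic (u t : R) (k : nat) :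
  Ioo a b t ->
  D k (fun s => quadratic (g s) (v s) (w s) u) t = quadratic (D k g t) (D k v t) (D k w t) u.
Proof.
  intros Ht.
  destruct Hg as (G1 & G2 & G3 & G4), Hv as (V1 & V2 & V3 & V4), Hw as (W1 & W2 & W3 & W4).
  pose proof (open_Ioo a b) as HU.
  repeat apply (f_equal2 pair).
  - exact (Derive_n_quadratic _ _ _ _ u t k HU G1 V1 W1 Ht).
  - exact (Derive_n_quadratic _ _ _ _ u t k HU G2 V2 W2 Ht).
  - exact (Derive_n_quadratic _ _ _ _ u t k HU G3 V3 W3 Ht).
  - exact (Derive_n_quadratic _ _ _ _ u t k HU G4 V4 W4 Ht).
Qed.

Lemma smooth_curve_quadratic (u : R) :
  smooth_curve a b (fun s => quadratic (g s) (v s) (w s) u).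
Proof.
  destruct Hg as (G1 & G2 & G3 & G4), Hv as (V1 & V2 & V3 & V4), Hw as (W1 & W2 & W3 & W4).
  pose proof (open_Ioo a b) as HU.
  split; [|split; [|split]];
    (apply smooth_on_plus; [exact HU|apply smooth_on_plus; [exact HU| |]|]);
    try assumption; apply smooth_on_mult; auto; apply smooth_on_const.
Qed.

Lemma inf_variation_quadratic (t : R) :
  inf_variation (fun t u => quadratic (g t) (v t) (w t) u) t = v t.
Proof.
  assert (H : forall A B C : R, Derive (fun u => A + u * B + u ^ 2 * C) 0 = B).
  { intros A B C. apply is_derive_unique. auto_derive; [easy|ring]. }
  transitivity (of_coords (fun x => x (v t))).
  - repeat apply (f_equal2 pair); apply H.
  - exact (D_0 v t).
Qed.

End Quadratic.

(** * Gluing and integrating smooth functions *)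

Lemma open_nonzero (U : R -> Prop) (f : R -> R) :
  open U -> smooth_on U f -> open (fun t => U t /\ f t <> 0).
Proof.
  intros HU Hf t [Ht Hnz]. apply filter_and; [now apply HU|].
  exact (smooth_on_continuous U f t Hf Ht _ (open_neq 0 _ Hnz)).
Qed.

Definition outside (U : R -> Prop) (c d t : R) : Prop := U t /\ (t < c \/ d < t).

Lemma open_outside (U : R -> Prop) (c d : R) : open U -> open (outside U c d).
Proof.
  intros HU. apply open_and; [easy|]. apply open_or; [apply open_lt|apply open_gt].
Qed.

Lemma Derive_n_outside (U : R -> Prop) (c d : R) (f : R -> R) (n : nat) (t : R) :
  open U -> (forall s, outside U c d s -> f s = 0) -> outside U c d t ->
  Derive_n f n t = 0.
Proof.
  intros HU Hf Ht.
  rewrite (Derive_n_agree (outside U c d) f (fun _ => 0) n t); auto using open_outside.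
  destruct n as [|n]; [easy|apply Derive_n_const].
Qed.

(** The denominator may vanish outside [c, d]; the numerator is zero there, and
    0 / x = 0 for every x, so the quotient is locally zero. *)
Lemma smooth_on_compact_quotient (U : R -> Prop) (c d : R) (f g : R -> R) :
  open U -> smooth_on U f -> smooth_on U g ->
  (forall t, c <= t <= d -> g t <> 0) ->
  (forall t, outside U c d t -> f t = 0) ->
  smooth_on U (fun t => f t / g t).
Proof.
  intros HU Hf Hg Hnz H0.
  apply (smooth_on_union (fun t => U t /\ g t <> 0) (outside U c d)).
  - intros t Ht. destruct (Rlt_dec t c); [right; split; auto|].
    destruct (Rlt_dec d t); [right; split; auto|].
    left; split; [easy|apply Hnz; lra].
  - pose proof (open_nonzero U g HU Hg) as HV.
    apply smooth_on_div; auto; try (now intros t [? ?]).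
    + apply (smooth_on_subset U); [now intros t [? ?]|easy].
    + apply (smooth_on_subset U); [now intros t [? ?]|easy].
  - apply (smooth_on_ext _ (open_outside U c d HU) (fun _ => 0)).
    + intros t Ht. rewrite (H0 t Ht). unfold Rdiv; ring.
    + apply smooth_on_const.
Qed.

Lemma smooth_primitive (a b : Rbar) (f : R -> R) (c : R) :
  smooth_on (Ioo a b) f -> Ioo a b c ->
  exists F, smooth_on (Ioo a b) F /\ forall t, Ioo a b t -> is_derive F t (f t).
Proof.
  intros Hf Hc. pose proof (open_Ioo a b) as HU.
  assert (HF : forall t, Ioo a b t -> is_derive (fun t => RInt f c t) t (f t)).
  { intros t Ht. apply (is_derive_RInt f (fun t => RInt f c t) c).
    - apply (filter_imp (Ioo a b)); [|now apply HU].
      intros s Hs. apply (RInt_correct (V := R_CompleteNormedModule)).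
      apply (ex_RInt_continuous (V := R_CompleteNormedModule)).
      intros z Hz. apply (smooth_on_continuous (Ioo a b)); auto.
      destruct (Rle_dec c s) as [Hcs|Hcs].
      + rewrite Rmin_left, Rmax_right in Hz by easy. now apply (Ioo_between a b c s).
      + rewrite Rmin_right, Rmax_left in Hz by lra. now apply (Ioo_between a b s c).
    - now apply (smooth_on_continuous (Ioo a b)). }
  exists (fun t => RInt f c t). split; [|exact HF].
  now apply (smooth_on_is_derive (Ioo a b) HU _ f).
Qed.

Lemma bounded_on_segment (f : R -> R) (c d : R) :
  (forall t, c <= t <= d -> continuous f t) ->
  exists M, 0 <= M /\ forall t, c <= t <= d -> Rabs (f t) <= M.
Proof.
  intros Hf. destruct (bounded_continuity f c d Hf) as [M HM].
  exists (Rmax 0 M). split; [apply Rmax_l|].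
  intros t Ht. apply Rle_trans with M; [left; exact (HM t Ht)|apply Rmax_r].
Qed.

(** * Constructing Lagrangian variations *)

(** With gamma_u = g + u v + u^2 w, the form Lambda(gamma_u', gamma_u'') is a
    polynomial of degree 4 in u.  The first group of hypotheses cancels its
    terms of degree 1 and 2, the two orthogonality hypotheses those of degree 3
    and 4.
    Likewise Lambda(gamma_u'', gamma_u''') = 1 + u a1 + u^2 a2, and since a1
    and a2 vanish outside a compact segment they are bounded, which gives one
    eps for all t. *)
Lemma quadratic_Lagrangian_variation (a b : Rbar) (g v w : R -> R4) (c d : R) :
  full_Lagrangian_curve a b g -> arclength_parameterized a b g ->
  smooth_curve a b v -> smooth_curve a b w ->
  Ioo a b c -> Ioo a b d ->
  (forall t, Ioo a b t ->
     Lambda (D 1 v t) (D 2 g t) + Lambda (D 1 g t) (D 2 v t) = 0 /\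
     Lambda (D 1 v t) (D 2 v t) + Lambda (D 1 w t) (D 2 g t) + Lambda (D 1 g t) (D 2 w t) = 0) ->
  (forall t i j, Ioo a b t -> (i <= 3)%nat -> Lambda (D i v t) (D j w t) = 0) ->
  (forall t i j, Ioo a b t -> Lambda (D i w t) (D j w t) = 0) ->
  (forall t, outside (Ioo a b) c d t ->
     Lambda (D 2 v t) (D 3 g t) + Lambda (D 2 g t) (D 3 v t) = 0 /\
     Lambda (D 2 v t) (D 3 v t) + Lambda (D 2 w t) (D 3 g t) + Lambda (D 2 g t) (D 3 w t) = 0) ->
  exists eps, Lagrangian_variation a b g eps (fun t u => quadratic (g t) (v t) (w t) u).
Proof.
  intros Hg Ha Hv Hw Hc Hd H12 Hvw Hww Hout.
  pose proof (proj1 (proj1 Hg)) as Hs. pose proof (open_Ioo a b) as HU.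
  (* The coefficients of u and u^2 in Lambda(gamma_u'', gamma_u'''). *)
  set (a1 := fun t => Lambda (D 2 v t) (D 3 g t) + Lambda (D 2 g t) (D 3 v t)) in Hout.
  set (a2 := fun t => Lambda (D 2 v t) (D 3 v t) + Lambda (D 2 w t) (D 3 g t)
                      + Lambda (D 2 g t) (D 3 w t)) in Hout.
  pose proof (fun j => smooth_curve_D a b g j Hs) as HDg.
  pose proof (fun j => smooth_curve_D a b v j Hv) as HDv.
  pose proof (fun j => smooth_curve_D a b w j Hw) as HDw.
  assert (S1 : smooth_on (Ioo a b) a1).
  { apply smooth_on_plus; [exact HU| |].
    - exact (smooth_on_Lambda a b _ _ (HDv 2%nat) (HDg 3%nat)).
    - exact (smooth_on_Lambda a b _ _ (HDg 2%nat) (HDv 3%nat)). }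
  assert (S2 : smooth_on (Ioo a b) a2).
  { apply smooth_on_plus; [exact HU|apply smooth_on_plus; [exact HU| |]|].
    - exact (smooth_on_Lambda a b _ _ (HDv 2%nat) (HDv 3%nat)).
    - exact (smooth_on_Lambda a b _ _ (HDw 2%nat) (HDg 3%nat)).
    - exact (smooth_on_Lambda a b _ _ (HDg 2%nat) (HDw 3%nat)). }
  assert (Hbound : forall f, smooth_on (Ioo a b) f ->
            (forall t, outside (Ioo a b) c d t -> f t = 0) ->
            exists M, 0 <= M /\ forall t, Ioo a b t -> Rabs (f t) <= M).
  { intros f Hf H0.
    destruct (bounded_on_segment f c d) as [M [HM0 HM]].
    - intros t Ht. apply (smooth_on_continuous (Ioo a b)); [exact Hf|].
      now apply (Ioo_between a b c d).
    - exists M; split; [easy|]. intros t Ht.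
      destruct (Rlt_dec t c) as [H|H]; [rewrite H0, Rabs_R0; [easy|split; auto]|].
      destruct (Rlt_dec d t) as [H'|H']; [rewrite H0, Rabs_R0; [easy|split; auto]|].
      apply HM; lra. }
  destruct (Hbound a1 S1) as [M1 [HM1 B1]]; [exact (fun t Ht => proj1 (Hout t Ht))|].
  destruct (Hbound a2 S2) as [M2 [HM2 B2]]; [exact (fun t Ht => proj2 (Hout t Ht))|].
  assert (Hden : 0 < 1 + M1 + M2) by lra.
  (* With |u| < 1 / (1 + M1 + M2) <= 1 one has |u a1 + u^2 a2| <= |u| (M1 + M2) < 1. *)
  exists (/ (1 + M1 + M2)).
  split; [exact (Rinv_0_lt_compat _ Hden)|]. split; [exact (smooth_family_quadratic a b g v w Hs Hv Hw _)|].
  split.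
  - intros u Hu. apply full_Lagrangian_curve_intro.
    + exact (smooth_curve_quadratic a b g v w Hs Hv Hw u).
    + intros t Ht. rewrite !(D_quadratic a b) by assumption.
      rewrite Lambda_quadratic.
      destruct (H12 t Ht) as [-> ->].
      rewrite (Lambda_antisym (D 1 w t) (D 2 v t)), !Hvw, Hww by (auto; lia).
      rewrite (proj2 (proj2 (proj1 Hg) t Ht)). ring.
    + intros t Ht. rewrite !(D_quadratic a b) by assumption.
      rewrite Lambda_quadratic.
      rewrite (Lambda_antisym (D 2 w t) (D 3 v t)), !Hvw, Hww by (auto; lia).
      rewrite (Ha t Ht). fold (a1 t). fold (a2 t).
      specialize (B1 t Ht). specialize (B2 t Ht).
      assert (Hu1 : Rabs u < / (1 + M1 + M2)) by (apply Rabs_def1; lra).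
      assert (Hu2 : Rabs u * (1 + M1 + M2) < 1).
      { apply (Rmult_lt_reg_r (/ (1 + M1 + M2))); [exact (Rinv_0_lt_compat _ Hden)|].
        rewrite Rmult_assoc, Rinv_r by lra. lra. }
      pose proof (Rabs_pos u) as Hu0.
      assert (E1 : Rabs (u * a1 t) <= Rabs u * M1)
        by (rewrite Rabs_mult; apply Rmult_le_compat_l; auto).
      assert (E2 : Rabs (u ^ 2 * a2 t) <= Rabs u * M2).
      { rewrite Rabs_mult, <- RPow_abs.
        apply Rmult_le_compat; [apply pow_le, Rabs_pos|apply Rabs_pos| |easy].
        assert (Rabs u <= 1) by nra. nra. }
      apply Rabs_le_between in E1. apply Rabs_le_between in E2. nra.
  - intros t Ht. unfold quadratic.
    transitivity (of_coords (fun x => x (g t))); [|exact (D_0 g t)].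
    repeat apply (f_equal2 pair); ring.
Qed.

(** The components p = Lambda(v, g') and q = Lambda(v, g'') of a variation field
    are free.  The constraint then determines Lambda(v, g''') by differentiation,
    and Lambda(v, g'''') is still free; it is spent on making v orthogonal to
    a fixed vector e, which is possible where Lambda(g', e) is not zero. *)
Lemma exists_variation_field (a b : Rbar) (g : R -> R4) (e : R4) (p q : R -> R) (c d : R) :
  full_Lagrangian_curve a b g -> arclength_parameterized a b g ->
  smooth_on (Ioo a b) p -> smooth_on (Ioo a b) q ->
  (forall t, outside (Ioo a b) c d t -> p t = 0) ->
  (forall t, outside (Ioo a b) c d t -> q t = 0) ->
  (forall t, c <= t <= d -> Lambda (D 1 g t) e <> 0) ->
  exists v, smooth_curve a b v /\
    (forall t, outside (Ioo a b) c d t -> v t = (0, 0, 0, 0)) /\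
    (forall t, Ioo a b t -> Lambda (v t) (D 1 g t) = p t) /\
    (forall t, Ioo a b t -> Lambda (v t) (D 2 g t) = q t) /\
    (forall t, Ioo a b t -> Lambda (v t) e = 0) /\
    (forall t, Ioo a b t ->
      Lambda (D 1 v t) (D 2 g t) + Lambda (D 1 g t) (D 2 v t) = 0).
Proof.
  intros Hg Ha Hp Hq Hp0 Hq0 Hphi.
  pose proof (proj1 (proj1 Hg)) as Hs. pose proof (open_Ioo a b) as HU.
  pose proof (fun j => smooth_curve_D a b g j Hs) as HDg.
  pose proof (fun j => smooth_on_Lambda a b _ _ (HDg j) (smooth_curve_const a b e)) as HLe.
  (* Differentiating p = Lambda(v, g') and q = Lambda(v, g'') turns the constraint
     into p'' - 3 q' + 2 r = 0 for r = Lambda(v, g'''). *)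
  set (r := fun t => (3 / 2) * Derive_n q 1 t - (1 / 2) * Derive_n p 2 t).
  (* The coordinates of v in the frame g', ..., g'''': the Gram matrix of the
     frame turns p, q, r into c4, c3, c2, and c1 makes Lambda(v, e) vanish. *)
  set (c4 := p). set (c3 := fun t => - q t). set (c2 := fun t => r t + kappa3 g t * p t).
  set (N := fun t => - (c2 t * Lambda (D 2 g t) e + c3 t * Lambda (D 3 g t) e + c4 t * Lambda (D 4 g t) e)).
  set (c1 := fun t => N t / Lambda (D 1 g t) e).
  assert (Sr : smooth_on (Ioo a b) r).
  { apply smooth_on_minus; [exact HU| |]; (apply smooth_on_mult; [exact HU|apply smooth_on_const|]);
      now apply smooth_on_Derive_n. }
  assert (S3 : smooth_on (Ioo a b) c3) by now apply smooth_on_opp.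
  assert (S2 : smooth_on (Ioo a b) c2).
  { apply smooth_on_plus; [exact HU|exact Sr|apply smooth_on_mult; [exact HU| |exact Hp]].
    exact (smooth_on_Lambda a b _ _ (HDg 3%nat) (HDg 4%nat)). }
  assert (SN : smooth_on (Ioo a b) N).
  { apply smooth_on_opp, smooth_on_plus; [exact HU|apply smooth_on_plus; [exact HU| |]|];
      (apply smooth_on_mult; [exact HU|assumption|apply HLe]). }
  assert (O2 : forall t, outside (Ioo a b) c d t -> c2 t = 0).
  { intros t Ht. unfold c2, r.
    rewrite (Derive_n_outside _ c d q 1 t HU Hq0 Ht), (Derive_n_outside _ c d p 2 t HU Hp0 Ht), Hp0 by easy.
    ring. }
  assert (O1 : forall t, outside (Ioo a b) c d t -> N t = 0).
  { intros t Ht. unfold N, c3, c4. rewrite O2, Hp0, Hq0 by easy. ring. }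
  assert (S1 : smooth_on (Ioo a b) c1)
    by exact (smooth_on_compact_quotient _ c d N _ HU SN (HLe 1%nat) Hphi O1).
  set (v := fun t => of_coords (fun x => c1 t * x (D 1 g t) + c2 t * x (D 2 g t)
                                 + c3 t * x (D 3 g t) + c4 t * x (D 4 g t))).
  assert (HL : forall t X, Lambda (v t) X =
     c1 t * Lambda (D 1 g t) X + c2 t * Lambda (D 2 g t) X
     + c3 t * Lambda (D 3 g t) X + c4 t * Lambda (D 4 g t) X)
    by (intros t X; unfold v; rewrite Lambda_of_coords_l; unfold Lambda; ring).
  assert (Hv : smooth_curve a b v).
  { destruct (HDg 1%nat) as (A1 & A2 & A3 & A4), (HDg 2%nat) as (B1 & B2 & B3 & B4),
      (HDg 3%nat) as (C1 & C2 & C3 & C4), (HDg 4%nat) as (D1 & D2 & D3 & D4).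
    split; [|split; [|split]].
    - exact (smooth_on_combination _ _ _ _ _ _ _ _ _ HU S1 S2 S3 Hp A1 B1 C1 D1).
    - exact (smooth_on_combination _ _ _ _ _ _ _ _ _ HU S1 S2 S3 Hp A2 B2 C2 D2).
    - exact (smooth_on_combination _ _ _ _ _ _ _ _ _ HU S1 S2 S3 Hp A3 B3 C3 D3).
    - exact (smooth_on_combination _ _ _ _ _ _ _ _ _ HU S1 S2 S3 Hp A4 B4 C4 D4). }
  assert (O : forall t, outside (Ioo a b) c d t -> v t = (0, 0, 0, 0)).
  { intros t Ht. unfold v, c1, c3, c4. rewrite (O1 t Ht), (O2 t Ht), Hp0, Hq0 by easy.
    repeat apply (f_equal2 pair); unfold Rdiv; ring. }
  assert (L1 : forall t, Ioo a b t -> Lambda (v t) (D 1 g t) = p t).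
  { intros t Ht. rewrite HL.
    destruct (arclength_frame a b g t Hg Ha Ht) as (H12 & H13 & H14 & _).
    rewrite Lambda_diag, (Lambda_antisym (D 2 g t)), (Lambda_antisym (D 3 g t)),
      (Lambda_antisym (D 4 g t)), H12, H13, H14.
    unfold c4; ring. }
  assert (L2 : forall t, Ioo a b t -> Lambda (v t) (D 2 g t) = q t).
  { intros t Ht. rewrite HL.
    destruct (arclength_frame a b g t Hg Ha Ht) as (H12 & H13 & H14 & H23 & H24 & _).
    rewrite Lambda_diag, (Lambda_antisym (D 3 g t)), (Lambda_antisym (D 4 g t)), H12, H23, H24.
    unfold c3; ring. }
  assert (L3 : forall t, Ioo a b t -> Lambda (v t) (D 3 g t) = r t).
  { intros t Ht. rewrite HL.
    destruct (arclength_frame a b g t Hg Ha Ht) as (H12 & H13 & H14 & H23 & H24 & _).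
    rewrite Lambda_diag, (Lambda_antisym (D 4 g t)), H13, H23. fold (kappa3 g t).
    unfold c2, c4; ring. }
  exists v. split; [exact Hv|]. split; [exact O|]. split; [exact L1|]. split; [exact L2|]. split.
  - intros t Ht.
    destruct (Rlt_dec t c); [rewrite O by (split; auto); apply Lambda_zero_l|].
    destruct (Rlt_dec d t); [rewrite O by (split; auto); apply Lambda_zero_l|].
    rewrite HL. unfold c1, N. field. apply Hphi; lra.
  - intros t Ht.
    pose proof (fun i j s (Hs' : Ioo a b s) => is_derive_Lambda _ _ _ _ _
      (is_derive_R4_D a b v i s Hv Hs') (is_derive_R4_D a b g j s Hs Hs')) as HD.
    assert (V0 : forall s, D 0 v s = v s) by (intros s; apply D_0).
    assert (E1 : forall s, Ioo a b s -> Lambda (D 1 v s) (D 1 g s) = Derive_n p 1 s - q s).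
    { intros s Hs'.
      assert (E := derivative_agree (Ioo a b) (fun s => Lambda (D 0 v s) (D 1 g s)) p s _ _ HU
        (fun z Hz => eq_trans (f_equal (fun Z => Lambda Z (D 1 g z)) (V0 z)) (L1 z Hz)) Hs'
        (HD 0%nat 1%nat s Hs') (smooth_on_step _ p 0 s Hp Hs')).
      rewrite V0, L2 in E by easy. lra. }
    assert (E2 : Lambda (D 1 v t) (D 2 g t) = Derive_n q 1 t - r t).
    { assert (E := derivative_agree (Ioo a b) (fun s => Lambda (D 0 v s) (D 2 g s)) q t _ _ HU
        (fun z Hz => eq_trans (f_equal (fun Z => Lambda Z (D 2 g z)) (V0 z)) (L2 z Hz)) Ht
        (HD 0%nat 2%nat t Ht) (smooth_on_step _ q 0 t Hq Ht)).
      rewrite V0, L3 in E by easy. lra. }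
    assert (E3 := derivative_agree (Ioo a b) _ _ t _ _ HU E1 Ht (HD 1%nat 1%nat t Ht)
      (is_derive_Rminus _ _ _ _ _ (smooth_on_step _ p 1 t Hp Ht) (smooth_on_step _ q 0 t Hq Ht))).
    rewrite (Lambda_antisym (D 1 g t)). unfold r in E2. lra.
Qed.

(** The field v extends to an actual variation g + u v + u^2 H e.  As v is
    orthogonal to e, only the term of degree 2 in u obstructs the Lagrangian condition,
    and with phi = Lambda(g', e) and H' = h phi it vanishes when
    h' = - Lambda(v', v'') / phi^2.  The primitives h and H do not return to
    zero past the support of v.  This is harmless: there h is constant and the
    curve has the derivative g' + u^2 h Lambda(g', e) e, the image of g' under
    a symplectic transvection, and H enters only at second order in u, so
    that the infinitesimal variation is still v. *)
Lemma exists_Lagrangian_variation (a b : Rbar) (g v : R -> R4) (e : R4) (c d : R) :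
  full_Lagrangian_curve a b g -> arclength_parameterized a b g ->
  smooth_curve a b v -> Ioo a b c -> Ioo a b d ->
  (forall t, outside (Ioo a b) c d t -> v t = (0, 0, 0, 0)) ->
  (forall t, c <= t <= d -> Lambda (D 1 g t) e <> 0) ->
  (forall t, Ioo a b t -> Lambda (v t) e = 0) ->
  (forall t, Ioo a b t -> Lambda (D 1 v t) (D 2 g t) + Lambda (D 1 g t) (D 2 v t) = 0) ->
  exists eps G, Lagrangian_variation a b g eps G /\ forall t, inf_variation G t = v t.
Proof.
  intros Hg Ha Hv Hc Hd Hout Hphi Hve H1.
  pose proof (proj1 (proj1 Hg)) as Hs. pose proof (open_Ioo a b) as HU.
  pose proof (fun j => smooth_curve_D a b g j Hs) as HDg.
  pose proof (fun j => smooth_curve_D a b v j Hv) as HDv.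
  pose proof (fun j => smooth_on_Lambda a b _ _ (HDg j) (smooth_curve_const a b e)) as HLe.
  assert (Hphi' : forall i t, Ioo a b t ->
    is_derive (fun s => Lambda (D i g s) e) t (Lambda (D (S i) g t) e)).
  { intros i t Ht. eapply is_derive_eq.
    - exact (is_derive_Lambda _ _ _ _ _ (is_derive_R4_D a b g i t Hs Ht) (is_derive_R4_const e t)).
    - rewrite Lambda_zero_r. ring. }
  assert (Dout : forall i t, outside (Ioo a b) c d t -> D i v t = (0, 0, 0, 0)).
  { intros i t Ht.
    repeat apply (f_equal2 pair); apply (Derive_n_outside (Ioo a b) c d); auto;
      intros s Hs'; now rewrite Hout. }
  set (phi := fun t => Lambda (D 1 g t) e).
  set (h' := fun t => - Lambda (D 1 v t) (D 2 v t) / (phi t * phi t)).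
  assert (Sh' : smooth_on (Ioo a b) h').
  { apply (smooth_on_compact_quotient _ c d); [exact HU| | | |].
    - apply smooth_on_opp. exact (smooth_on_Lambda a b _ _ (HDv 1%nat) (HDv 2%nat)).
    - exact (smooth_on_mult _ HU _ _ (HLe 1%nat) (HLe 1%nat)).
    - intros t Ht. pose proof (Hphi t Ht). now apply Rmult_integral_contrapositive.
    - intros t Ht. rewrite !Dout, Lambda_zero_l by easy. ring. }
  assert (Oh' : forall t, outside (Ioo a b) c d t -> h' t = 0).
  { intros t Ht. unfold h'. rewrite !Dout, Lambda_zero_l by easy. unfold Rdiv; ring. }
  destruct (smooth_primitive a b h' c Sh' Hc) as [h [Sh Dh]].
  destruct (smooth_primitive a b (fun t => h t * phi t) c
              (smooth_on_mult _ HU _ _ Sh (HLe 1%nat)) Hc) as [H [SH DH]].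
  set (w := fun t => of_coords (fun x => H t * x e)).
  assert (Hw : smooth_curve a b w).
  { split; [|split; [|split]]; apply (smooth_on_mult _ HU H (fun _ => _) SH), smooth_on_const. }
  assert (Lw : forall X j t, Lambda (D j w t) X = Derive_n H j t * Lambda e X).
  { intros X j t. unfold w. rewrite D_scal_const, Lambda_of_coords_l. unfold Lambda; ring. }
  assert (Lw' : forall X j t, Lambda X (D j w t) = Derive_n H j t * Lambda X e).
  { intros X j t. rewrite Lambda_antisym, Lw, (Lambda_antisym X e). ring. }
  assert (E1 : forall t, Ioo a b t -> Derive_n H 1 t = h t * Lambda (D 1 g t) e).
  { intros t Ht. exact (is_derive_unique _ _ _ (DH t Ht)). }
  assert (E2 : forall t, Ioo a b t ->
    Derive_n H 2 t = h' t * Lambda (D 1 g t) e + h t * Lambda (D 2 g t) e).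
  { intros t Ht.
    exact (derivative_agree _ _ _ t _ _ HU E1 Ht (smooth_on_step _ H 1 t SH Ht)
             (is_derive_Rmult _ _ _ _ _ (Dh t Ht) (Hphi' 1%nat t Ht))). }
  assert (E3 : forall t, Ioo a b t ->
    Derive_n H 3 t = Derive_n h' 1 t * Lambda (D 1 g t) e + h' t * Lambda (D 2 g t) e
       + (h' t * Lambda (D 2 g t) e + h t * Lambda (D 3 g t) e)).
  { intros t Ht.
    exact (derivative_agree _ _ _ t _ _ HU E2 Ht (smooth_on_step _ H 2 t SH Ht)
      (is_derive_Rplus _ _ _ _ _
        (is_derive_Rmult _ _ _ _ _ (smooth_on_step _ h' 0 t Sh' Ht) (Hphi' 1%nat t Ht))
        (is_derive_Rmult _ _ _ _ _ (Dh t Ht) (Hphi' 2%nat t Ht)))). }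
  destruct (quadratic_Lagrangian_variation a b g v w c d Hg Ha Hv Hw Hc Hd) as [eps Heps].
  - intros t Ht. split; [exact (H1 t Ht)|].
    rewrite Lw, Lw', E1, E2, (Lambda_antisym e) by easy. unfold h'. fold (phi t).
    destruct (Rlt_dec t c) as [Hlt|Hlt];
      [rewrite !Dout, Lambda_zero_l by (split; auto); unfold Rdiv; ring|].
    destruct (Rlt_dec d t) as [Hlt'|Hlt'];
      [rewrite !Dout, Lambda_zero_l by (split; auto); unfold Rdiv; ring|].
    field. exact (Hphi t (conj (Rnot_lt_le _ _ Hlt) (Rnot_lt_le _ _ Hlt'))).
  - intros t i j Ht _. rewrite Lw', (Lambda_D_const a b) by assumption. ring.
  - intros t i j Ht. rewrite Lw, Lw', Lambda_diag. ring.
  - intros t Ht. pose proof (proj1 Ht) as HtU. rewrite (Dout 2%nat t Ht), (Dout 3%nat t Ht).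
    rewrite (Lambda_zero_l (D 3 g t)), (Lambda_zero_r (D 2 g t)), (Lambda_zero_l (0, 0, 0, 0)).
    split; [ring|].
    rewrite Lw, Lw', E2, E3, (Lambda_antisym e) by easy.
    rewrite (Oh' t Ht), (Derive_n_outside _ c d h' 1 t HU Oh' Ht). ring.
  - exists eps, (fun t u => quadratic (g t) (v t) (w t) u). split; [exact Heps|].
    apply inf_variation_quadratic.
Qed.

(** * Critical points of arc-length *)

Lemma adherence_segment (S : R -> Prop) (c d t : R) :
  (forall s, S s -> c <= s <= d) -> adherence S t -> c <= t <= d.
Proof.
  intros HS Ht. split; apply Rnot_lt_le; intros Hlt.
  - assert (Hp : 0 < c - t) by lra.
    destruct (Ht (disc t (mkposreal _ Hp))) as [s [Hs1 Hs2]].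
    { exists (mkposreal _ Hp). now intros s Hs. }
    specialize (HS s Hs2). unfold disc in Hs1; simpl in Hs1.
    apply Rabs_def2 in Hs1. lra.
  - assert (Hp : 0 < t - d) by lra.
    destruct (Ht (disc t (mkposreal _ Hp))) as [s [Hs1 Hs2]].
    { exists (mkposreal _ Hp). now intros s Hs. }
    specialize (HS s Hs2). unfold disc in Hs1; simpl in Hs1.
    apply Rabs_def2 in Hs1. lra.
Qed.

(** Minimality places [k, l] inside the segment that carries the support, hence
    inside the open interval. *)
Lemma compact_support_interval (a b : Rbar) (v : R -> R4) (k l : R) :
  compactly_supported a b v -> smallest_closed_interval (support a b v) k l ->
  k <= l /\ Ioo a b k /\ Ioo a b l /\
  forall t, Ioo a b t -> ~ (k <= t <= l) -> v t = (0, 0, 0, 0).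
Proof.
  intros (c & d & Hcd & Hc & Hd & Hv) (Hkl & Hin & Hmin).
  destruct (Hmin c d Hcd) as [Hck Hld].
  { intros t Ht. apply (adherence_segment _ c d t) in Ht; [easy|].
    intros s [Hs Hvs]. apply NNPP. intros Hn. apply Hvs. now apply Hv. }
  split; [easy|]. split; [|split].
  - apply (Ioo_between a b c d); auto; lra.
  - apply (Ioo_between a b c d); auto; lra.
  - intros t Ht Hn. apply NNPP. intros Hvt. apply Hn, Hin.
    apply adherence_P1. now split.
Qed.

Lemma critical_of_Euler_Lagrange (a b : Rbar) (g : R -> R4) :
  full_Lagrangian_curve a b g -> arclength_parameterized a b g ->
  (forall t, Ioo a b t -> euler1 g t = 0) -> (forall t, Ioo a b t -> euler2 g t = 0) ->
  Lagrangian_geodesic a b g.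
Proof.
  intros Hg Ha He1 He2. split; [exact Hg|].
  intros eps G HG Hcs k l Hkl.
  destruct (compact_support_interval a b _ k l Hcs Hkl) as (Hle & Hk & Hl & Hv).
  eapply is_derive_eq; [now apply (first_variation a b g eps G k l)|].
  rewrite (RInt_ext _ (fun _ => 0)).
  - rewrite RInt_const. unfold scal; simpl; unfold mult; simpl. ring.
  - intros t Ht. rewrite Rmin_left, Rmax_right in Ht by easy.
    assert (HtU : Ioo a b t) by (apply (Ioo_between a b k l); auto; lra).
    rewrite He1, He2, !Rmult_0_l by easy. exact (Rplus_0_l 0).
Qed.

(** If one of the Euler-Lagrange expressions is nonzero at t0, prescribe the free
    components of the variation field as their values at t0 times a bump near
    t0: the first variation becomes the integral of a positive function. *)
Lemma Euler_Lagrange_of_critical (a b : Rbar) (g : R -> R4) (t0 : R) :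
  arclength_parameterized a b g -> Lagrangian_geodesic a b g -> Ioo a b t0 ->
  euler1 g t0 = 0 /\ euler2 g t0 = 0.
Proof.
  intros Ha [Hg Hcrit] Ht0. apply NNPP. intros Hne.
  pose proof (proj1 (proj1 Hg)) as Hs. pose proof (open_Ioo a b) as HU.
  pose proof (fun j => smooth_curve_D a b g j Hs) as HDg.
  set (E1 := euler1 g t0) in *. set (E2 := euler2 g t0) in *.
  assert (Hpos : 0 < E1 * E1 + E2 * E2).
  { destruct (Req_dec E1 0) as [H|H]; destruct (Req_dec E2 0) as [H'|H']; nra. }
  (* Lambda(g', e) = -1 at t0, so it does not vanish nearby. *)
  set (e := D 4 g t0).
  pose proof (smooth_on_Lambda a b _ _ (HDg 1%nat) (smooth_curve_const a b e)) as Hphi.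
  assert (Hphi0 : Lambda (D 1 g t0) e <> 0).
  { destruct (arclength_frame a b g t0 Hg Ha Ht0) as (_ & _ & H14 & _).
    unfold e; rewrite H14; lra. }
  (* The variation field below has Lambda(v, g') = E1 b and Lambda(v, g'') = E2 b
     for a bump b, so that F b is the integrand of the first variation. *)
  set (F := fun t => euler1 g t * E1 + euler2 g t * E2).
  assert (HF : smooth_on (Ioo a b) F).
  { destruct (smooth_euler a b g Hs) as [S1 S2].
    exact (smooth_on_plus _ HU _ _ (smooth_on_mult _ HU _ _ S1 (smooth_on_const _ E1))
             (smooth_on_mult _ HU _ _ S2 (smooth_on_const _ E2))). }
  destruct (filter_and _ _ (open_nonzero _ _ HU Hphi t0 (conj Ht0 Hphi0))
    (smooth_on_continuous _ F t0 HF Ht0 _ (open_gt 0 (F t0) Hpos))) as [r Hr].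
  pose proof (cond_pos r) as Hr0.
  set (c := t0 - r / 2). set (d := t0 + r / 2).
  assert (Hball : forall t, c <= t <= d -> (Ioo a b t /\ Lambda (D 1 g t) e <> 0) /\ 0 < F t).
  { intros t Ht. apply Hr. unfold ball; simpl; unfold AbsRing_ball, abs, minus, plus, opp; simpl.
    unfold c, d in Ht. apply Rabs_def1; lra. }
  assert (Hcd : c < d) by (unfold c, d; lra).
  assert (Hc : Ioo a b c) by (apply Hball; lra).
  assert (Hd : Ioo a b d) by (apply Hball; lra).
  assert (Hb0 : forall t, outside (Ioo a b) c d t -> bump c d t = 0).
  { intros t [_ Ht]; apply bump_zero; lra. }
  assert (Sb : smooth_on (Ioo a b) (bump c d))
    by (apply (smooth_on_subset (fun _ => True)); [easy|apply smooth_bump]).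
  destruct (exists_variation_field a b g e (fun t => E1 * bump c d t) (fun t => E2 * bump c d t) c d)
    as (v & Hv & Hv0 & Hv1 & Hv2 & Hve & Hvc).
  - exact Hg.
  - exact Ha.
  - exact (smooth_on_mult _ HU _ _ (smooth_on_const _ E1) Sb).
  - exact (smooth_on_mult _ HU _ _ (smooth_on_const _ E2) Sb).
  - intros t Ht; rewrite Hb0 by easy; ring.
  - intros t Ht; rewrite Hb0 by easy; ring.
  - intros t Ht; now apply Hball.
  - destruct (exists_Lagrangian_variation a b g v e c d Hg Ha Hv Hc Hd Hv0) as (eps & G & HG & HGv).
    + intros t Ht; now apply Hball.
    + exact Hve.
    + exact Hvc.
    + assert (Hout : forall t, Ioo a b t -> ~ (c <= t <= d) -> inf_variation G t = (0, 0, 0, 0)).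
      { intros t Ht Hn. rewrite HGv. apply Hv0. split; [easy|lra]. }
      assert (Hin : forall t, c < t < d -> support a b (inf_variation G) t).
      { intros t Ht. apply adherence_P1.
        assert (HtU : Ioo a b t) by (apply Hball; lra).
        split; [easy|]. rewrite HGv. intros Hz. change (v t = (0, 0, 0, 0)) in Hz.
        pose proof (bump_pos c d t Ht) as Hb.
        specialize (Hv1 t HtU). specialize (Hv2 t HtU).
        rewrite Hz, Lambda_zero_l in Hv1. rewrite Hz, Lambda_zero_l in Hv2.
        assert (E1 = 0) by nra. assert (E2 = 0) by nra. nra. }
      assert (Hsmall : smallest_closed_interval (support a b (inf_variation G)) c d).
      { split; [lra|split].
        - intros t Ht. apply (adherence_segment _ c d t) in Ht; [easy|].
          intros s [HsU Hvs]. apply NNPP. intros Hn. apply Hvs. now apply Hout.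
        - intros c' d' Hcd' HS. split; apply Rnot_lt_le; intros Hlt.
          + pose proof (Rmin_l c' d). pose proof (Rmin_r c' d).
            assert (Hm : c < Rmin c' d) by (apply Rmin_glb_lt; lra).
            destruct (HS ((c + Rmin c' d) / 2)); [apply Hin; lra|lra].
          + pose proof (Rmax_l d' c). pose proof (Rmax_r d' c).
            assert (Hm : Rmax d' c < d) by (apply Rmax_lub_lt; lra).
            destruct (HS ((d + Rmax d' c) / 2)); [apply Hin; lra|lra]. }
      assert (Hcs : compactly_supported a b (inf_variation G)).
      { exists c, d. split; [lra|]. split; [easy|split; [easy|exact Hout]]. }
      pose proof (is_derive_unique _ _ _ (Hcrit eps G HG Hcs c d Hsmall)) as Hz.
      assert (Hcd' : c <= d) by lra.
      rewrite (is_derive_unique _ _ _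
        (first_variation a b g eps G c d Hg Ha HG Hcd' Hc Hd Hout)) in Hz.
      rewrite (RInt_ext _ (fun t => F t * bump c d t)) in Hz.
      * assert (Hgt : 0 < RInt (fun t => F t * bump c d t) c d); [|lra].
        apply RInt_gt_0; [exact Hcd| |].
        -- intros t Ht. apply Rmult_lt_0_compat; [apply Hball; lra|now apply bump_pos].
        -- intros t Ht. apply (smooth_on_continuous (Ioo a b)); [|apply Hball; exact Ht].
           exact (smooth_on_mult _ HU _ _ HF Sb).
      * intros t Ht. rewrite Rmin_left, Rmax_right in Ht by lra.
        assert (HtU : Ioo a b t) by (apply Hball; lra).
        rewrite HGv, Hv1, Hv2 by easy. unfold F.
        match goal with |- @eq _ ?x ?y => change (@eq R x y) end. ring.
Qed.

Theorem theorem5p4 :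
  forall (a b : Rbar) (g : R -> R4),
    Rbar_lt a b ->
    full_Lagrangian_curve a b g ->
    arclength_parameterized a b g ->
    (Lagrangian_geodesic a b g <->
     (exists c : R, forall t : R, Ioo a b t -> kappa3 g t = c) /\
     (forall t : R, Ioo a b t -> kappa4 g t = kappa3 g t ^ 2)).
Proof.
  intros a b g Hab Hg Ha.
  pose proof (proj1 (proj1 Hg)) as Hs. pose proof (open_Ioo a b) as HU.
  split.
  - intros Hgeo.
    pose proof (fun t Ht => Euler_Lagrange_of_critical a b g t Ha Hgeo Ht) as HEL.
    split.
    + destruct (Ioo_inhabited a b Hab) as [t0 Ht0].
      exists (kappa3 g t0). intros t Ht.
      apply (constant_on_Ioo a b (kappa3 g)); auto.
      intros s Hs'. eapply is_derive_eq; [now apply (is_derive_kappa3 a b)|].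
      now apply HEL.
    + intros t Ht.
      pose proof (derivative_of_constant _ _ 0 t _ HU (fun s Hs' => proj2 (HEL s Hs')) Ht
        (is_derive_euler2 a b g t Hs Ht)) as E.
      pose proof (proj1 (HEL t Ht)) as E1. unfold euler1 in E1. lra.
  - intros [[c Hc] H4].
    assert (He2 : forall t, Ioo a b t -> euler2 g t = 0).
    { intros t Ht. exact (derivative_of_constant _ _ c t _ HU Hc Ht (is_derive_kappa3 a b g t Hs Ht)). }
    apply critical_of_Euler_Lagrange; auto.
    intros t Ht. unfold euler1.
    rewrite (derivative_of_constant _ _ 0 t _ HU He2 Ht (is_derive_euler2 a b g t Hs Ht)).
    rewrite (H4 t Ht). ring.
Qed.
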